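(* Let $p$ be a prime. Each finite, non-degenerate, indecomposable, involutive set-theoretical solution $(X,r)$ to the Yang--Baxter equation of size $p^2$ is isomorphic to one of the following solutions: (1) $X = \mathbb{Z}_{p^2}$ with $r(x,y) = (y+1,x-1)$. (2) $X = \mathbb{Z}_p \times \mathbb{Z}_p$ with $$r\begin{pmatrix} (a,x) \\ (b,y) \end{pmatrix} = \begin{pmatrix} ( b-1,\ y- \chi_0(b-1)S - \Phi(b-1-a))\\ (a+1,\ x + \chi_0(a)S + \Phi(a-b+1)) \end{pmatrix}$$ where $\Phi: \mathbb{Z}_p \to \mathbb{Z}_p$ is a non-constant map with $\Phi(0) = 0$, $S \in \mathbb{Z}_p$, and $\chi_0: \mathbb{Z}_p \to \mathbb{Z}_p$ is given by $\chi_0(0)=1$ and $\chi_0(x)=0$ for $x\neq 0$. The parameters $(S,\Phi)$ and $(S',\Phi')$ define isomorphic solutions if and only if there is $\alpha \in \mathbb{Z}_p^{*}$ with $\alpha S = S'$ and $\alpha \Phi = \Phi'$. (3) $X = \mathbb{Z}_p \times \mathbb{Z}_p$ with $$r\begin{pmatrix} (a,x) \\ (b,y) \end{pmatrix} = \begin{pmatrix} (\alpha^{-1}b - x,\ \alpha^{-1} y - \Phi(\alpha^{-1}b - x-a)) \\ (\alpha a + y - \Phi(b - \alpha x - \alpha a),\ \alpha x + \Phi(\alpha a + \alpha x - b)) \end{pmatrix}$$ where $\Phi: \mathbb{Z}_p \to \mathbb{Z}_p$ is a non-constant map with $\Phi(x) = \Phi(-x)$ for all $x\in\mathbb{Z}_p$,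 and $\alpha \in \mathbb{Z}_p^{*}$ is such that $\Phi(\alpha x) = \alpha \Phi(x)$ for all $x\in\mathbb{Z}_p$. The parameters $(\alpha, \Phi)$ and $(\alpha', \Phi')$ define isomorphic solutions if and only if $\alpha = \alpha'$ and there is a $\beta \in \mathbb{Z}_p^{*}$ such that $\beta^{-1} \Phi(\beta x) = \Phi'(x)$ for all $x \in \mathbb{Z}_p$.
   Context: A set-theoretical solution to the Yang--Baxter equation is a pair $(X,r)$ with $X$ a set and $r:X^2\to X^2$ a bijection such that $(r \times \mathrm{id}_X) (\mathrm{id}_X \times r)(r \times \mathrm{id}_X) = (\mathrm{id}_X \times r)(r \times \mathrm{id}_X) (\mathrm{id}_X \times r)$ on $X^3$. Write $r(x,y)=(\lambda_x(y),\rho_y(x))$. The solution is non-degenerate if all $\lambda_x,\rho_x$ are bijective, and involutive if $r^2=\mathrm{id}_{X^2}$. Its size is $|X|$. It is indecomposable if there is no partition $X=A\sqcup B$ with $A,B\neq\emptyset$, $r(A^2)=A^2$ and $r(B^2)=B^2$. A homomorphism $f:(X,r)\to(Y,s)$ is a map $f:X\to Y$ with $(f\times f)r=s(f\times f)$; an isomorphism is a bijective homomorphism. In the column notation, the column with entries $u,v\in X$ stands for the pair $(u,v)\in X^2$. $\mathbb{Z}_n$ denotes the integers modulo $n$, and $\mathbb{Z}_p^*$ the multiplicative group of the field $\mathbb{Z}_p$. *)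

(* Defs.v *)
From mathcomp Require Import all_boot all_algebra.

Set Implicit Arguments.
Unset Strict Implicit.
Unset Printing Implicit Defensive.

Import GRing.Theory.
Local Open Scope ring_scope.

Section YangBaxter.

Variables (X : Type) (r : X * X -> X * X).

(* X^3 is X * X * X = (X * X) * X, hence the reassociation in [id_times]. *)
Definition times_id (t : X * X * X) : X * X * X := (r t.1, t.2).

Definition id_times (t : X * X * X) : X * X * X :=
  let: (x, y, z) := t in let: (y', z') := r (y, z) in (x, y', z').

Definition yb_solution : Prop :=
  bijective r /\
  times_id \o id_times \o times_id =1 id_times \o times_id \o id_times.

Definition lambda (x y : X) : X := (r (x, y)).1.
Definition rho (y x : X) : X := (r (x, y)).2.

Definition nondegenerate : Prop :=
  (forall x, bijective (lambda x)) /\ (forall y, bijective (rho y)).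

End YangBaxter.

Definition indecomposable (X : finType) (r : X * X -> X * X) : Prop :=
  ~ exists A B : {set X},
      [/\ A :|: B = setT, [disjoint A & B], A != set0 & B != set0] /\
      (r @: setX A A = setX A A /\ r @: setX B B = setX B B).

Definition indecomposable_solution (X : finType) (r : X * X -> X * X) : Prop :=
  [/\ yb_solution r, nondegenerate r, involutive r & indecomposable r].

Definition yb_hom (X Y : Type) (r : X * X -> X * X) (s : Y * Y -> Y * Y)
    (f : X -> Y) : Prop :=
  let ff (u : X * X) := (f u.1, f u.2) in ff \o r =1 s \o ff.

Definition yb_isomorphic (X Y : Type)
    (r : X * X -> X * X) (s : Y * Y -> Y * Y) : Prop :=
  exists2 f : X -> Y, bijective f & yb_hom r s f.

Definition nonconstant (S T : Type) (f : S -> T) : Prop :=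
  ~ exists c : T, forall x, f x = c.

(* For prime p, 'F_p is Z_p and 'Z_(p ^ 2) is Z_{p^2}; in the definitions
   below these readings are only meant for prime p. *)

Definition cyclic_map (p : nat) (u : 'Z_(p ^ 2) * 'Z_(p ^ 2)) :
    'Z_(p ^ 2) * 'Z_(p ^ 2) :=
  let: (x, y) := u in (y + 1, x - 1).

Definition chi0 (p : nat) (x : 'F_p) : 'F_p := if x == 0 then 1 else 0.

Definition translation_map (p : nat) (S : 'F_p) (Phi : 'F_p -> 'F_p)
    (u : ('F_p * 'F_p) * ('F_p * 'F_p)) : ('F_p * 'F_p) * ('F_p * 'F_p) :=
  let: ((a, x), (b, y)) := u in
  ((b - 1, y - chi0 (b - 1) * S - Phi (b - 1 - a)),
   (a + 1, x + chi0 a * S + Phi (a - b + 1))).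

Definition translation_param (p : nat) (Phi : 'F_p -> 'F_p) : Prop :=
  nonconstant Phi /\ Phi 0 = 0.

Definition scaling_map (p : nat) (alpha : 'F_p) (Phi : 'F_p -> 'F_p)
    (u : ('F_p * 'F_p) * ('F_p * 'F_p)) : ('F_p * 'F_p) * ('F_p * 'F_p) :=
  let: ((a, x), (b, y)) := u in
  ((alpha^-1 * b - x,
    alpha^-1 * y - Phi (alpha^-1 * b - x - a)),
   (alpha * a + y - Phi (b - alpha * x - alpha * a),
    alpha * x + Phi (alpha * a + alpha * x - b))).

Definition scaling_param (p : nat) (alpha : 'F_p) (Phi : 'F_p -> 'F_p) : Prop :=
  [/\ nonconstant Phi, forall x, Phi x = Phi (- x),
      alpha != 0 & forall x, Phi (alpha * x) = alpha * Phi x].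

(* Main.v *)
(* An involutive solution is encoded by the permutations sg x = lambda_x^-1,
   which satisfy the cycle set law sg_(sg_x y) sg_x = sg_(sg_y x) sg_y. The maps
   t |-> sg_(t x) o t commute; they generate an abelian group of
   translations of the permutation brace. Splitting each of them into its
   p-part and p'-part factors sg through a cycle set s1 whose group P is a
   transitive p-group and a cycle set s2 whose group Q is a p'-group.
   A central element of order p of P gives coordinates (b, y) on X in which
   s1 (a, x) (b, y) = (b + c (a, x), y + psi (a, x) b), and a counting argument
   gives an automorphism z of s1 lying in P. If z fixes the blocks, c is constant
   and s1 is of translation type. If z moves them, c and psi do not depend on the
   first coordinates up to a shift, and comparing the degrees of functions on F_p
   shows that s1 is of translation type or is the scaling solution with alpha = 1.
   In the first case P normalises Q, hence Q = 1; in the second case s2 is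
   constant, equal to a map (b, y) |-> (alpha b + e, alpha y). *)


Require Import Defs.
From mathcomp Require Import all_boot all_fingroup all_solvable all_algebra.
From mathcomp Require Import ring.

Set Implicit Arguments.
Unset Strict Implicit.
Unset Printing Implicit Defensive.

Import GroupScope GRing.Theory.

(** * The permutation brace and its primary pieces *)

(** Products of permutations compose from left to right. The permutation group of a solution need
    not be a p-group, and a Sylow subgroup does not visibly inherit a solution. The translations do
    split: their primary parts are powers, so they still commute and are still equivariant, and
    evaluating the commutation of two parts at the identity gives the cycle set law for each part
    and an exchange law between them. The price is that P and Q are tied only by a twisted
    conjugation, whose conjugating element changes from [s1 u] to [s1 (tau u)]. Neither group is
    known to normalise the other, so Q is controlled by comparing orbit sizes. The automorphism [z]
    matters because it removes one variable from the cycle law; what remains is a functional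
    equation on ['F_p], where a degree argument applies. For odd p the evenness of [Phi] supplies
    reflections; for p = 2 it says nothing, which forces separate arguments. [chi0] and [S] appear
    because a function on a cyclic group can be changed by a coboundary until only its total sum
    remains. *)

Section Translations.

Variable X : finType.
Implicit Types (h t : {perm X}) (s : X -> {perm X}).

Definition cycle_set s := forall x y, s x * s (s x y) = s y * s (s y x).

Definition precomp h : {perm {perm X}} := perm (mulgI h).

Lemma precompE h t : precomp h t = h * t.
Proof. by rewrite permE. Qed.

Lemma precompM h t : precomp h * precomp t = precomp (t * h).
Proof. by apply/permP=> u; rewrite permM !precompE mulgA. Qed.

Lemma precomp1 : precomp 1 = 1.
Proof. by apply/permP=> u; rewrite precompE mul1g perm1. Qed.

Lemma precompV h : (precomp h)^-1 = precomp h^-1.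
Proof.
by apply/eqP; rewrite eq_invg_mul precompM mulVg precomp1.
Qed.

(* An equivariant family is determined by its values at the identity; its
   members then behave like additive translations of the permutation brace. *)
Definition equivariant (Th : X -> {perm {perm X}}) :=
  forall x h, Th x ^ precomp h = Th (h^-1 x).

Lemma equivariantE Th x t : equivariant Th -> Th x t = t * Th (t x) 1.
Proof.
move=> eqTh; have := eqTh (t x) t; rewrite permK => <-.
by rewrite conjgE precompV !permM !precompE mulVg.
Qed.

(** [Th x t] is [t * Th (t x) 1], and conversely right multiplication of [t] by [Th x 1] is
    [Th (t^-1 x)] applied to [t]. The group on X is thus an orbit, so its order divides that of the
    translation group. *)
Lemma equivariant_orbit Th : equivariant Th ->
  orbit 'P <<[set Th x | x : X]>> 1 = <<[set Th x 1 | x : X]>>.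
Proof.
move=> eqTh; set T := <<_>>; set P := <<_>>.
have memT x : Th x \in T by rewrite mem_gen ?imset_f.
apply/eqP; rewrite eqEsubset; apply/andP; split.
  rewrite acts_sub_orbit ?group1 // gen_subG.
  apply/subsetP=> _ /imsetP[x _ ->]; rewrite !inE /=.
  apply/subsetP=> t Pt; rewrite inE /= /aperm equivariantE //.
  by rewrite groupM // mem_gen ?imset_f.
have actsO: [acts P, on orbit 'P T 1 | 'R].
  rewrite gen_subG; apply/subsetP=> _ /imsetP[x _ ->]; rewrite !inE /=.
  apply/subsetP=> t Ot; rewrite inE /=.
  have ->: t * Th x 1 = Th (t^-1 x) t by rewrite (equivariantE _ t eqTh) permKV.
  set y := t^-1 x; case/orbitP: Ot => k Tk <-.
  rewrite -[Th y _]/('P%act ('P%act 1 k) (Th y)) -actM.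
  by apply: mem_orbit; rewrite groupM.
apply/subsetP=> g Pg; rewrite -[g]mul1g.
by have := acts_act actsO Pg 1; rewrite orbit_refl.
Qed.

Lemma equivariant_pgroup pi Th : equivariant Th ->
  pi.-group <<[set Th x | x : X]>> -> pi.-group <<[set Th x 1 | x : X]>>.
Proof.
move=> eqTh; rewrite /pgroup -(equivariant_orbit eqTh) card_orbit.
by apply: pnat_dvd; rewrite dvdn_indexg.
Qed.

Lemma equivariant_comm Th1 Th2 x y :
    equivariant Th1 -> equivariant Th2 -> commute (Th1 x) (Th2 y) ->
  Th1 x 1 * Th2 (Th1 x 1 y) 1 = Th2 y 1 * Th1 (Th2 y 1 x) 1.
Proof.
move=> eq1 eq2 /permP/(_ 1); rewrite !permM.
by rewrite (equivariantE _ (Th1 x 1) eq2) (equivariantE _ (Th2 y 1) eq1).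
Qed.

End Translations.

Section Brace.
Variables (X : finType) (sg : X -> {perm X}).
Hypothesis sgC : cycle_set sg.
Hypothesis sg_sq : injective (fun u => sg u u).

(** Evaluation at [x] yields equal squares [sg u u] at [t x] and [t' x]; hence these points agree
    and the factor [sg (t x)] cancels. *)
Lemma translation_inj x : injective (fun t : {perm X} => t * sg (t x)).
Proof.
move=> t t' /= eq_tt; have /permP/(_ x) := eq_tt; rewrite !permM => /sg_sq eqx.
by move: eq_tt; rewrite eqx => /mulIg.
Qed.

Definition translation x := perm (@translation_inj x).

Lemma translationE x t : translation x t = t * sg (t x).
Proof. by rewrite permE. Qed.

Lemma translation_comm x y : commute (translation x) (translation y).
Proof.
apply/permP=> t; rewrite !permM !translationE -!mulgA !permM.
by rewrite sgC.
Qed.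

Lemma translation_equivariant : equivariant translation.
Proof.
move=> x h; apply/permP=> t; rewrite conjgE precompV !permM !precompE.
by rewrite !translationE permM mulgA mulKVg.
Qed.

Lemma translation1 x : translation x 1 = sg x.
Proof. by rewrite translationE mul1g perm1. Qed.

Definition piece pi x := (translation x).`_pi 1.

Lemma piece_equivariant pi : equivariant (fun x => (translation x).`_pi).
Proof. by move=> x h; rewrite -consttJ translation_equivariant. Qed.

Lemma piece_comm pi rho x y :
  commute (translation x).`_pi (translation y).`_rho.
Proof.
by apply: commuteX2; apply: translation_comm.
Qed.

Lemma constt_translation_group pi :
  pi.-group <<[set (translation x).`_pi | x : X]>>.
Proof.
set S := [set _ | _ in _].
have abS: abelian <<S>>.
  rewrite abelian_gen abelianE; apply/centsP=> _ /imsetP[x _ ->] _ /imsetP[y _ ->].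
  exact: piece_comm.
apply: pgroupS (pcore_pgroup pi <<S>>).
have nilS := abelian_nil abS.
rewrite gen_subG; apply/subsetP=> _ /imsetP[x _ ->].
rewrite (mem_normal_Hall (nilpotent_pcore_Hall pi nilS)) ?pcore_normal ?p_elt_constt //.
by apply: mem_gen; apply/imsetP; exists x.
Qed.

Lemma piece_group pi : pi.-group <<[set piece pi x | x : X]>>.
Proof.
exact: equivariant_pgroup (piece_equivariant pi) (constt_translation_group pi).
Qed.

Lemma piece_cycle_set pi : cycle_set (piece pi).
Proof.
move=> x y; exact: (equivariant_comm (piece_equivariant pi)
  (piece_equivariant pi) (piece_comm pi pi x y)).
Qed.

Lemma piece_compat pi x y :
  piece pi x * piece pi^' (piece pi x y) =
    piece pi^' y * piece pi (piece pi^' y x).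
Proof.
exact: (equivariant_comm (piece_equivariant pi) (piece_equivariant pi^')
  (piece_comm pi pi^' x y)).
Qed.

Lemma piece_factor pi x : sg x = piece pi x * piece pi^' (piece pi x x).
Proof.
rewrite -translation1 -{1}(consttC pi (translation x)) permM.
exact: (equivariantE _ _ (piece_equivariant pi^')).
Qed.

(** Write [tau] as [k 1] with [k] a product of pi'-translations. As [k] commutes with the pi-part at
    [u], applying both to the identity in either order shows that the element is the value at 1 of a
    conjugate of [k], which stays in the translation group by equivariance. *)
Lemma piece_conj pi u tau : tau \in <<[set piece pi^' x | x : X]>> ->
  (piece pi u)^-1 * tau * piece pi (tau u) \in <<[set piece pi^' x | x : X]>>.
Proof.
rewrite -{1}(equivariant_orbit (piece_equivariant pi^')) => /orbitP[k Tk /= <-].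
pose s := piece pi u; rewrite -/s /aperm.
have eqk : k 1 * piece pi (k 1 u) = s * (k ^ (precomp s)^-1) 1.
  rewrite -(equivariantE u (k 1) (piece_equivariant pi)).
  rewrite conjgE invgK !permM.
  have cuk: commute (translation u).`_pi k.
    apply/cent1P; rewrite cent1C; apply: subsetP Tk; rewrite gen_subG.
    apply/subsetP=> _ /imsetP[x _ ->]; apply/cent1P; exact: piece_comm.
  rewrite -permM -cuk permM -/s -[LHS]/(k s) precompV !precompE.
  by rewrite mulg1 mulKVg.
rewrite -mulgA eqk mulKg -(equivariant_orbit (piece_equivariant pi^')).
apply/orbitP; exists (k ^ (precomp s)^-1) => //=.
rewrite precompV memJ_norm //; apply: (subsetP (norm_gen _)).
rewrite inE; apply/subsetP=> _ /imsetP[_ /imsetP[x _ ->] ->].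
by rewrite (piece_equivariant pi^'); apply/imsetP; exists (s^-1^-1 x).
Qed.
End Brace.

(** The degree divides [#|G : P|] times the length of a P-orbit, and is coprime to the first
    factor. *)
Lemma Hall_transitive (aT : finGroupType) (X : finType)
    (to : {action aT &-> X}) (pi : nat_pred) (P G : {group aT}) :
    pi.-Hall(G) P -> pi.-nat #|X| -> [transitive G, on setT | to] ->
  [transitive P, on setT | to].
Proof.
move=> /and3P[sPG piP pi'PG] piX trG.
have [x _ _] := imsetP trG; apply/imsetP; exists x => //.
apply/esym/eqP; rewrite eqEcard subsetT cardsT /=.
suff: #|X| %| #|orbit to P x| by apply: dvdn_leq; rewrite card_orbit indexg_gt0.
have ->: #|X| = #|G : 'C_G[x | to]|.
  by rewrite -card_orbit (atransP trG) ?inE // cardsT.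
rewrite card_orbit.
have sub1: 'C_P[x | to] \subset 'C_G[x | to] by apply: setSI.
have coPG: coprime #|G : 'C_G[x | to]| #|G : P|.
  rewrite -card_orbit (atransP trG) ?inE // cardsT.
  exact: pnat_coprime piX pi'PG.
rewrite -(Gauss_dvdr _ coPG) Lagrange_index ?subsetIl //.
by rewrite -(Lagrange_index _ sub1) ?subsetIl // dvdn_mulr.
Qed.

Section FixedTranslation.
Variables (X : finType) (s : X -> {perm X}) (Th : X -> {perm {perm X}}) (p : nat).
Let T := <<[set Th x | x : X]>>.
Let P := <<[set s x | x : X]>>.
Hypothesis eqTh : equivariant Th.
Hypothesis ThE : forall x, Th x 1 = s x.
Hypothesis p_pr : prime p.
Hypothesis pT : p.-group T.

Lemma Th_mul x t : Th x t = t * s (t x).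
Proof. by rewrite (equivariantE _ _ eqTh) ThE. Qed.

Lemma gens_pgroup : p.-group P.
Proof.
rewrite /P (eq_imset _ (fun x => esym (ThE x))).
exact: equivariant_pgroup.
Qed.

Definition precomp_inv (h : {perm X}) := precomp h^-1.

Lemma precomp_invM : {in setT &, {morph precomp_inv : h t / h * t}}.
Proof. by move=> h t _ _; rewrite /precomp_inv precompM invMg. Qed.

Canonical precomp_inv_morphism := Morphism precomp_invM.

(* The points of P fixed by the p-group generated by the permutations
   t |-> (precomp (s u))^-1 (Th u t) are the automorphisms of s lying in P; the
   identity is one of them, hence there is another. *)
Lemma exists_automorphism : P != 1 ->
  exists z, [/\ z \in P, #[z] = p & forall u, s u * z = z * s (z u)].
Proof.
move=> ntP.
pose Rp := precomp_inv_morphism @* P.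
have pR : p.-group Rp by apply: morphim_pgroup gens_pgroup.
have nTR : Rp \subset 'N(T).
  apply/subsetP=> _ /morphimP[h _ _ ->]; apply: (subsetP (norm_gen _)).
  rewrite inE; apply/subsetP=> _ /imsetP[_ /imsetP[x _ ->] ->] /=.
  by rewrite eqTh imset_f.
(* [Rp] normalises [T] by equivariance, so the join, which contains every [m u] below, is a
   p-group. *)
have pM : p.-group (T <*> Rp) by rewrite norm_joinEr // pgroupM pT.
pose m u := Th u * (precomp (s u))^-1.
have mE u t : (m u t == t) = (t * s (t u) == s u * t).
  rewrite /m permM precompV precompE Th_mul.
  exact: (can2_eq (mulKVg (s u)) (mulKg (s u))).
pose M := <<[set m u | u : X]>>.
have pM' : p.-group M.
  apply: pgroupS pM; rewrite gen_subG; apply/subsetP=> _ /imsetP[u _ ->].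
  apply: groupM.
    by apply: (subsetP (joing_subl _ _)); rewrite mem_gen ?imset_f.
  apply: (subsetP (joing_subr _ _)); rewrite precompV.
  by apply: (mem_morphim precomp_inv_morphism); rewrite ?inE // mem_gen ?imset_f.
have actM : [acts M, on P | 'P].
  rewrite gen_subG; apply/subsetP=> _ /imsetP[u _ ->]; rewrite !inE /=.
  apply/subsetP=> t Pt; rewrite inE /= /aperm /m permM precompV precompE Th_mul.
  by rewrite !groupM ?groupV // mem_gen ?imset_f.
pose A := [set z in P | [forall u, z * s (z u) == s u * z]].
have defA : 'Fix_(P | 'P)(M) = A.
  rewrite afix_gen; apply/setP=> z; rewrite in_setI [RHS]inE; congr (_ && _).
  apply/afixP/forallP=> [fixz u|autz _ /imsetP[u _ ->]].
    by rewrite -mE; apply/eqP/fixz; rewrite imset_f.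
  by apply/eqP; rewrite /= /aperm mE.
have gA : group_set A.
  apply/group_setP; split=> [|y z].
    by rewrite inE group1; apply/forallP=> u; rewrite mul1g mulg1 perm1.
  rewrite !inE => /andP[Py /forallP autY] /andP[Pz /forallP autZ].
  rewrite groupM //; apply/forallP=> u; rewrite permM -mulgA (eqP (autZ _)).
  by rewrite !mulgA (eqP (autY _)).
have pA : p %| #|Group gA|.
  have [_ pdvP _] := pgroup_pdiv gens_pgroup ntP.
  have := pgroup_fix_mod pM' actM; rewrite defA => /eqP eqA.
  by rewrite /dvdn /= -(eqP eqA).
have [z] := Cauchy p_pr pA; rewrite inE => /andP[Pz /forallP autz] oz.
by exists z; split=> // u; rewrite (eqP (autz u)).
Qed.
End FixedTranslation.

Notation gens s := <<[set s x | x : _]>>.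

Lemma transitiveS (aT : finGroupType) (X : finType)
    (to : {action aT &-> X}) (H G : {group aT}) :
    H \subset G -> [transitive H, on setT | to] -> [transitive G, on setT | to].
Proof.
move=> sHG trH; have [x _ _] := imsetP trH; apply/imsetP; exists x => //.
apply/esym/eqP; rewrite eqEsubset subsetT -(atransP trH x) ?inE //=.
exact: imsetS.
Qed.

(** [h * tau * s1 v] is [h * s1 (tau^-1 v)] times the twisted conjugate of [tau] at [tau^-1 v], so
    the product set is closed under right multiplication by both kinds of generators. *)
Lemma matched_pair_group (X : finType) (s1 s2 : X -> {perm X}) :
    (forall u tau, tau \in gens s2 -> (s1 u)^-1 * tau * s1 (tau u) \in gens s2) ->
  gens s1 * gens s2 = gens s1 <*> gens s2.
Proof.
set P := gens s1; set Q := gens s2 => conjQ.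
have PQ1 x : s1 x \in P by rewrite mem_gen ?imset_f.
apply/eqP; rewrite eqEsubset mulG_subG joing_subl joing_subr /=.
have actR : [acts P <*> Q, on P * Q | 'R].
  rewrite join_subG; apply/andP; split; rewrite gen_subG;
    apply/subsetP=> _ /imsetP[v _ ->]; rewrite !inE /=;
    apply/subsetP=> _ /mulsgP[h tau Ph Qtau ->]; rewrite inE /=.
  - have := conjQ (tau^-1 v) tau Qtau; rewrite permKV; set q := _ * _ => Qq.
    apply/mulsgP; exists (h * s1 (tau^-1 v)) q => //; first by rewrite groupM.
    by rewrite /q !mulgA mulgK.
  apply/mulsgP; exists h (tau * s2 v); rewrite ?mulgA //.
  by rewrite groupM // mem_gen ?imset_f.
apply/subsetP=> g PQg; rewrite -[g]mul1g.
by have := acts_act actR PQg 1; rewrite /= => ->; rewrite -[1]mulg1 mem_mulg.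
Qed.

Lemma pgroup_pieces (X : finType) (sg : X -> {perm X}) (p : nat) :
    cycle_set sg -> injective (fun u => sg u u) -> prime p ->
    p.-nat #|X| -> 1 < #|X| -> [transitive gens sg, on setT | 'P] ->
  exists s1 s2 : X -> {perm X},
  [/\ cycle_set s1, p.-group (gens s1), [transitive gens s1, on setT | 'P]
    & exists z, [/\ z \in gens s1, #[z] = p & forall u, s1 u * z = z * s1 (z u)]] /\
  [/\ p^'.-group (gens s2), forall u, sg u = s1 u * s2 (s1 u u),
      forall u v, s1 u * s2 (s1 u v) = s2 v * s1 (s2 v u)
    & forall u tau, tau \in gens s2 -> (s1 u)^-1 * tau * s1 (tau u) \in gens s2].
Proof.
move=> sgC sg_sq p_pr pX ntX trG.
pose s1 := piece sg_sq p; pose s2 := piece sg_sq p^'.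
have pP : p.-group (gens s1) by apply: piece_group.
have pQ : p^'.-group (gens s2) by apply: piece_group.
have conjQ := @piece_conj _ _ sgC sg_sq p.
have fact u : sg u = s1 u * s2 (s1 u u) by apply: piece_factor.
have defPQ : gens s1 * gens s2 = gens s1 <*> gens s2 := matched_pair_group conjQ.
have trP : [transitive gens s1, on setT | 'P].
  apply: (@Hall_transitive _ _ _ p _ (gens s1 <*> gens s2)) pX _.
    rewrite pHallE joing_subl /= -/s1 -/s2 -defPQ.
    rewrite coprime_cardMg ?(pnat_coprime pP pQ) //.
    by rewrite partnM ?cardG_gt0 // part_pnat_id // part_p'nat ?muln1.
  apply: transitiveS trG; rewrite gen_subG; apply/subsetP=> _ /imsetP[u _ ->].
  by rewrite /= fact -defPQ mem_mulg // mem_gen ?imset_f.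
have ntP : gens s1 != 1.
  apply/eqP=> P1; have [x _ defX] := imsetP trP; move: ntX.
  rewrite -cardsT defX card_orbit ltnNge (leq_trans (dvdn_leq _ (dvdn_indexg _ _))) //.
  by rewrite /= P1 cards1.
exists s1, s2; split; split=> //.
- exact: piece_cycle_set.
- exact: (@exists_automorphism _ s1 _ p (piece_equivariant sg_sq p)
    (fun=> erefl) p_pr (constt_translation_group sgC sg_sq p) ntP).
by move=> u v; exact: (piece_compat sgC sg_sq p).
Qed.

(** Serves as induction along a transitive group; forward closure under the generators is enough
    because X is finite. *)
Lemma transitive_stable (X : finType) (s : X -> {perm X}) (A : pred X) x :
    [transitive gens s, on setT | 'P] -> (forall u y, A y -> A (s u y)) ->
  A x -> forall y, A y.
Proof.
move=> trs As Ax y.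
have actA : [acts gens s, on [set w | A w] | 'P].
  rewrite gen_subG; apply/subsetP=> _ /imsetP[u _ ->]; rewrite !inE /=.
  by apply/subsetP=> w; rewrite !inE; apply: As.
have : y \in orbit 'P (gens s) x by rewrite (atransP trs) inE.
case/orbitP=> h Ph <-; have := acts_act actA Ph x; rewrite !inE.
by rewrite Ax.
Qed.


(** All orbits have the same length, which divides both the p-power [#|S|] and the p'-number [#|K|],
    hence is 1. *)
Lemma equal_orbits_fix (aT : finGroupType) (Y : finType) (to : {action aT &-> Y})
    (K : {group aT}) (S : {set Y}) (p : nat) :
    p^'.-group K -> p.-nat #|S| -> [acts K, on S | to] ->
    {in S &, forall y z, #|orbit to K y| <= #|orbit to K z|} ->
  {in S & K, forall y k, to y k = y}.
Proof.
move=> p'K pS actK le_orb y k Sy Kk.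
have p_orb : p.-nat #|orbit to K y|.
  apply: pnat_dvd pS; rewrite -(acts_sum_card_orbit actK).
  rewrite (eq_bigr (fun=> #|orbit to K y|)) => [|_ /imsetP[z Sz ->]].
    by rewrite sum_nat_const dvdn_mull.
  by apply/eqP; rewrite eqn_leq !le_orb.
have p'_orb : p^'.-nat #|orbit to K y|.
  by apply: pnat_dvd p'K; rewrite card_orbit dvdn_indexg.
have /eqP/cards1P[z def_z] := pnat_1 p_orb p'_orb.
have : to y k \in orbit to K y by apply: mem_orbit.
have : y \in orbit to K y by apply: orbit_refl.
by rewrite def_z !inE => /eqP-> /eqP->.
Qed.

Lemma normalized_orbits_fix (aT : finGroupType) (Y : finType) (to : {action aT &-> Y})
    (K P : {group aT}) (S : {set Y}) (p : nat) :
    p^'.-group K -> p.-nat #|S| -> [acts K, on S | to] -> P \subset 'N(K) ->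
    [transitive P, on S | to] -> {in S & K, forall y k, to y k = y}.
Proof.
move=> p'K pS actK nKP trP; apply: (equal_orbits_fix p'K pS actK) => y z Sy Sz.
have : z \in orbit to P y by rewrite (atransP trP).
case/orbitP=> h Ph <-; rewrite -(card_setact to _ h); apply: subset_leq_card.
apply/subsetP=> _ /imsetP[w Kw ->].
by rewrite -(normsP nKP h Ph) orbit_conjsg.
Qed.

(** * The p'-piece over a translation type p-piece *)

Section Complement.
Variables (p : nat) (X : finType) (s1 s2 : X -> {perm X}).
Let P := gens s1.
Let Q := gens s2.
Hypothesis p_pr : prime p.
Hypothesis cardX : #|X| = (p ^ 2)%N.
Hypothesis s1C : cycle_set s1.
Hypothesis pP : p.-group P.
Hypothesis trP : [transitive P, on setT | 'P].
Hypothesis p'Q : p^'.-group Q.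
Hypothesis conjQ : forall u tau, tau \in Q -> (s1 u)^-1 * tau * s1 (tau u) \in Q.

Lemma complement_TI : P :&: Q = 1.
Proof. by apply: coprime_TIg; apply: pnat_coprime pP p'Q. Qed.

(* Q acts on the classes of the relation s1 u = s1 u'; since all s1 u act alike
   on these classes, they permute the Q-orbits of classes. *)
Lemma complement_trivial :
  (forall u u' v, s1 (s1 u v) = s1 (s1 u' v)) -> forall v, s2 v = 1.
Proof.
move=> s1_level.
have s1P u : s1 u \in P by rewrite mem_gen ?imset_f.
(* The twisted conjugates at [u] and [u'] share the factor [(s1 u)^-1 * tau], so their quotient lies
   in the trivial group [P :&: Q]. *)
have Q_class tau u u' : tau \in Q -> s1 u = s1 u' -> s1 (tau u) = s1 (tau u').
  move=> Qtau eq_u; apply/eqP; rewrite eq_sym eq_mulVg1; apply/eqP/set1P.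
  rewrite -[[set 1]]complement_TI inE groupM ?groupV //=.
  have := groupM (groupVr (conjQ u' Qtau)) (conjQ u Qtau).
  by rewrite eq_u !invMg !mulgA !invgK mulgK mulgKV.
have P_class w u u' : s1 u = s1 u' -> s1 (s1 w u) = s1 (s1 w u').
  move=> eq_u; apply: (mulgI (s1 w)).
  by rewrite s1C eq_u -s1C.
have P_class_inj w u u' : s1 (s1 w u) = s1 (s1 w u') -> s1 u = s1 u'.
  move=> eq_u; apply: (mulIg (s1 (s1 u w))).
  by rewrite [in RHS](s1_level u u' w) (s1C u w) (s1C u' w) eq_u.
pose C u := [set v | s1 v == s1 u].
have imC (g : {perm X}) u : (forall v v', (s1 v == s1 v') = (s1 (g v) == s1 (g v'))) ->
    'P^*%act (C u) g = C (g u).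
  move=> gE; apply/setP=> v; rewrite /= /setact [RHS]inE; apply/imsetP/idP=> [[v' + ->]|].
    by rewrite inE gE.
  by exists (g^-1 v); rewrite /= /aperm ?permKV // inE gE permKV.
have imCs w u : 'P^*%act (C u) (s1 w) = C (s1 w u).
  by apply: imC => v v'; apply/eqP/eqP=> [/P_class|/P_class_inj].
have imCQ tau u : tau \in Q -> 'P^*%act (C u) tau = C (tau u).
  move=> Qtau; apply: imC => v v'; apply/eqP/eqP=> [/(Q_class _ _ _ Qtau)//|].
  by move/(Q_class _ _ _ (groupVr Qtau)); rewrite !permK.
pose S := [set C x | x : X].
have actP : [acts P, on S | 'P^*].
  rewrite gen_subG; apply/subsetP=> _ /imsetP[u _ ->]; rewrite !inE /=.
  by apply/subsetP=> _ /imsetP[x _ ->]; rewrite inE imCs imset_f.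
have actQ : [acts Q, on S | 'P^*].
  apply/subsetP=> tau Qtau; rewrite !inE /=.
  by apply/subsetP=> _ /imsetP[x _ ->]; rewrite inE imCQ // imset_f.
have [x0 _ _] := imsetP trP.
have orbS x : C x \in orbit 'P^* P (C x0).
  apply: (@transitive_stable _ _ (fun x => C x \in orbit 'P^* P (C x0)) x0 trP)
    (orbit_refl _ _ _) x => u y /orbitP[h Ph eqC].
  by rewrite -imCs -eqC -actM mem_orbit // groupM // mem_gen ?imset_f.
have pS : p.-nat #|S|.
  have -> : S = orbit 'P^* P (C x0).
    apply/eqP; rewrite eqEsubset acts_sub_orbit // imset_f // andbT.
    by apply/subsetP=> _ /imsetP[x _ ->].
  by apply: pnat_dvd pP; rewrite card_orbit dvdn_indexg.
(* [s1 u] sends the Q-orbit of [C y] into that of [C (s1 u y)]: up to class it may be replaced by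
   [s1 (tau u)], which turns [tau] into its twisted conjugate [q]. *)
have mono x y : #|orbit 'P^* Q (C x)| <= #|orbit 'P^* Q (C y)|.
  apply: (@transitive_stable _ _
    (fun y => #|orbit 'P^* Q (C x)| <= #|orbit 'P^* Q (C y)|) x trP) (leqnn _) y => u {}y /leq_trans; apply.
  rewrite -(card_imset _ (act_inj 'P^* (s1 u))); apply: subset_leq_card.
  apply/subsetP=> _ /imsetP[_ /orbitP[tau Qtau <-] ->].
  rewrite imCQ // imCs.
  have Qq := conjQ u Qtau; set q := _ * _ in Qq.
  have -> : C (s1 u (tau y)) = C (q (s1 u y)).
    by rewrite /C /q !permM permK (s1_level u (tau u)).
  by rewrite -imCQ // mem_orbit.
have fixC x tau : tau \in Q -> s1 (tau x) = s1 x.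
  move=> Qtau; have Sx : C x \in S by apply: imset_f.
  have := equal_orbits_fix p'Q pS actQ _ Sx Qtau.
  rewrite imCQ // => eqC; apply/eqP; have : tau x \in C (tau x) by rewrite inE.
  by rewrite eqC ?inE // => _ _ /imsetP[y _ ->] /imsetP[y' _ ->].
(* Once [Q] preserves every value of [s1], the twisted conjugation is an honest one. *)
have nPQ : P \subset 'N(Q).
  rewrite gen_subG; apply/subsetP=> _ /imsetP[u _ ->]; rewrite inE.
  apply/subsetP=> _ /imsetP[tau Qtau ->].
  by have := conjQ u Qtau; rewrite fixC // conjgE mulgA.
have pX : p.-nat #|[set: X]| by rewrite cardsT cardX pnatX pnat_id.
have actT : [acts Q, on [set: X] | 'P].
  by apply/subsetP=> g _; rewrite !inE; apply/subsetP=> x; rewrite !inE.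
move=> v; apply/permP=> x; rewrite perm1.
apply: (normalized_orbits_fix p'Q pX actT nPQ trP (in_setT x)).
by rewrite mem_gen ?imset_f.
Qed.
End Complement.

(** * Coordinates for transitive p-groups of degree p^2 *)

Section IndexHom.
Variables (gT : finGroupType) (p : nat) (H P : {group gT}).
Hypotheses (p_pr : prime p) (nHP : H <| P) (iHP : #|P : H| = p).

Lemma index_prime_morph : exists c : gT -> 'F_p,
  {in P &, forall x y, c (x * y)%g = (c x + c y)%R} /\
  {in P, forall x, (c x == 0%R) = (x \in H)}.
Proof.
have oPH : #|P / H| = p by rewrite card_quotient ?normal_norm.
have cycPH : cyclic (P / H) by rewrite prime_cyclic ?oPH.
have [a defa] := cyclicP cycPH.
have oa : #[a] = p by rewrite -oPH defa.
pose c x := odflt 0%R [pick k : 'F_p | coset H x == a ^+ k].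
have cP x : x \in P -> coset H x = a ^+ c x.
  move=> Px; rewrite /c; case: pickP => [k /eqP //|no].
  have /cycleP[i def_i] : coset H x \in <[a]> by rewrite -defa mem_quotient.
  have /eqP[] := no (i%:R)%R.
  by rewrite def_i -(expg_mod_order a i) oa val_Fp_nat.
have c_inj (i j : 'F_p) : a ^+ i = a ^+ j -> i = j.
  move/eqP; rewrite eq_expg_mod_order oa => /eqP eq_ij.
  by rewrite -[i]natr_Zp -[j]natr_Zp -Fp_nat_mod // eq_ij Fp_nat_mod.
have nH x : x \in P -> x \in 'N(H) by apply/subsetP/normal_norm.
exists c; split=> [x y Px Py|x Px].
  apply: c_inj; rewrite -cP ?groupM // morphM ?nH //= !cP //.
  by rewrite -expgD -(expg_mod_order a (_ + _)) oa -val_Fp_nat // natrD !natr_Zp.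
apply/eqP/idP=> [c0|Hx].
  by apply: coset_idr; rewrite ?nH // cP // c0.
by apply: c_inj; rewrite -cP // coset_id.
Qed.
End IndexHom.

Section Coordinates.
Variables (p : nat) (X : finType) (P : {group {perm X}}).
Hypotheses (p_pr : prime p) (pP : p.-group P) (cardX : #|X| = (p ^ 2)%N).
Hypothesis trP : [transitive P, on setT | 'P].

Lemma expg_Fp (t : {perm X}) (a b : 'F_p) : t ^+ p = 1 ->
  t ^+ (a + b)%R = t ^+ a * t ^+ b.
Proof.
move=> tp; rewrite -expgD -[a in LHS]natr_Zp -[b in LHS]natr_Zp -natrD.
by rewrite val_Fp_nat // [in RHS](divn_eq (a + b) p) expgD mulnC expgM tp expg1n mul1g.
Qed.

Lemma transitive_image x y : exists2 h, h \in P & h x = y.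
Proof.
have : y \in orbit 'P P x by rewrite (atransP trP) inE.
by case/orbitP=> h Ph <-; exists h.
Qed.

Lemma card_point_stabilizer x : #|P| = (p ^ 2 * #|'C_P[x | 'P]|)%N.
Proof.
by rewrite -cardX -cardsT -(atransP trP x (in_setT x)) card_orbit_stab.
Qed.

(** A central [z] of order p acts freely, by transitivity, and its orbits are the blocks. A point
    stabiliser and [z] generate a normal subgroup of index p, the kernel of [c]; so [c h] is the
    shift of blocks under [h]. The element [t] linking the blocks is left open, so that an
    automorphism can be taken for it later. *)
Theorem exists_coordinates : exists c : {perm X} -> 'F_p,
  [/\ {in P &, forall g h, c (g * h) = (c g + c h)%R},
      exists2 t, t \in P & c t = 1%R
    & forall t, t \in P -> c t = 1%R ->
      exists (E : 'F_p * 'F_p -> X) (psi : {perm X} -> 'F_p -> 'F_p),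
      [/\ bijective E,
          forall h, h \in P -> forall b y, h (E (b, y)) = E (b + c h, y + psi h b)%R
        & t ^+ p = 1 -> forall b, psi t b = 0%R]].
Proof.
have p_gt1 := prime_gt1 p_pr.
have ntP : P != 1%G.
  apply/eqP=> P1; have [x _ _] := imsetP trP; have := card_point_stabilizer x.
  rewrite P1 cards1 => /esym/eqP; rewrite muln_eq1 -mulnn muln_eq1.
  by rewrite eqn_leq leqNgt p_gt1.
have [x0 _ _] := imsetP trP.
have [z Zz oz] : {z | z \in 'Z(P) & #[z] = p}.
  apply: Cauchy => //.
  have pZ : p.-group 'Z(P) := pgroupS (center_sub _) pP.
  have ntZ : 'Z(P) != 1 by rewrite center_nil_eq1 ?(pgroup_nil pP).
  by have [] := pgroup_pdiv pZ ntZ.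
have [Pz cPz] := setIP Zz.
have zp : z ^+ p = 1 by rewrite -oz expg_order.
have comm_z h (y : nat) x : h \in P -> h ((z ^+ y) x) = (z ^+ y) (h x).
  move=> Ph; rewrite -!permM; congr (fun_of_perm _ x).
  by apply/esym/commuteX/esym/(centP cPz).
pose C := 'C_P[x0 | 'P]; pose Z := <[z]>.
have CE h : (h \in C) = (h \in P) && (h x0 == x0).
  by rewrite !inE sub1set inE.
have ZI : C :&: Z = 1.
  apply/trivgP/subsetP=> h /setIP[]; rewrite CE => /andP[Ph /eqP hx0] /cycleP[k def_h].
  rewrite inE; apply/eqP/permP=> x; rewrite perm1; have [g Pg <-] := transitive_image x0 x.
  by rewrite def_h -comm_z // -def_h hx0.
have cCZ : Z \subset 'C(C).
  by rewrite cycle_subG; apply: subsetP cPz; rewrite centS ?subsetIl.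
pose H := (C <*> Z)%G.
have oH : #|P : H| = p.
  have sHP : H \subset P by rewrite join_subG subsetIl cycle_subG.
  apply/eqP; rewrite -(eqn_pmul2l (cardG_gt0 H)) Lagrange //.
  have -> : #|H| = (#|C| * p)%N.
    by rewrite /= cent_joinEr // TI_cardMg // -orderE oz.
  by rewrite (card_point_stabilizer x0) -/C mulnC -mulnA mulnn.
have nHP : H <| P.
  apply: (p_maximal_normal pP); apply: p_index_maximal; rewrite ?oH //.
  by rewrite join_subG subsetIl cycle_subG.
have [c [cM c0]] := index_prime_morph p_pr nHP oH.
have cz : c z = 0%R.
  by apply/eqP; rewrite c0 // (subsetP (joing_subr _ _)) ?cycle_id.
have cC h : h \in C -> c h = 0%R.
  move=> Ch; apply/eqP; rewrite c0 ?(subsetP (joing_subl _ _)) //.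
  by case/setIP: Ch.
have c1 : c 1 = 0%R by apply: cC; apply: group1.
have cX h n : h \in P -> c (h ^+ n) = (c h *+ n)%R.
  by move=> Ph; elim: n => [|n IH]; rewrite ?expgS ?cM ?groupX ?IH ?mulrS.
have cV h : h \in P -> c h^-1 = (- c h)%R.
  by move=> Ph; apply/eqP; rewrite -addr_eq0 -cM ?groupV // mulVg c1.
exists c; split=> //.
  have [t Pt nHt] : exists2 t, t \in P & t \notin H.
    apply/subsetPn; rewrite -indexg_eq1 oH; apply: contraL p_gt1 => /eqP->.
    by rewrite ltnn.
  exists (t ^+ (c t)^-1%R); rewrite ?groupX // cX // -mulr_natr natr_Zp divff //.
  by rewrite c0.
move=> t Pt ct.
pose E (u : 'F_p * 'F_p) := (z ^+ u.2) ((t ^+ u.1) x0).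
have cE (b y : 'F_p) : c (t ^+ b * z ^+ y) = b.
  by rewrite cM ?groupX // !cX // ct cz mul0rn addr0 natr_Zp.
have E_block h h' : h \in P -> h' \in P -> h x0 = h' x0 -> c h = c h'.
  move=> Ph Ph' eqx; apply/eqP; rewrite -subr_eq0 -cV // -cM ?groupV //.
  by apply/eqP/cC; rewrite CE groupM ?groupV // permM eqx permK eqxx.
have EE b y : E (b, y) = (t ^+ b * z ^+ y) x0 by rewrite permM.
have E_inj : injective E.
  move=> [b y] [b' y'] eqE; have eqb : b = b'.
    by rewrite -(cE b y) -(cE b' y'); apply: E_block; rewrite -?EE // groupM ?groupX.
  congr pair => //; move: eqE; rewrite /E /= -eqb -!comm_z ?groupX // => /perm_inj eqz.
  have Ck : z ^+ (y - y')%R \in C :&: Z.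
    rewrite inE mem_cycle andbT CE groupX //.
    apply/eqP/(@perm_inj _ (z ^+ y')); rewrite -permM -expg_Fp // subrK //.
  have /eqP := set1P (etrans (congr1 (fun A : {set _} => _ \in A) (esym ZI)) Ck).
  rewrite -order_dvdn oz => /eqP; rewrite modn_small => [/eqP|].
    by rewrite -[_ == _]/((y - y')%R == 0%R) subr_eq0 => /eqP.
  by rewrite -[X in _ < X](Fp_cast p_pr).
have E_bij : bijective E.
  by apply: inj_card_bij => //; rewrite cardX card_prod card_Fp.
have [E' EK E'K] := E_bij.
pose psi h b := (E' (h (E (b, 0%R)))).2.
exists E, psi; split=> //.
  move=> h Ph b y; rewrite /psi.
  case defE: (E' _) => [b1 y1] /=; have {defE}hE : h (E (b, 0%R)) = E (b1, y1).
    by rewrite -defE E'K.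
  have def_b1 : b1 = (b + c h)%R.
    rewrite -(cE b1 y1) -{1}[b](cE b 0%R) -cM ?groupM ?groupX //.
    by apply: E_block; rewrite ?groupM ?groupX // -EE -hE permM EE.
  rewrite -def_b1 addrC {1}/E /= comm_z //.
  have -> : (t ^+ b) x0 = E (b, 0%R) by rewrite EE mulg1.
  by rewrite hE /E /= -permM -expg_Fp // addrC.
move=> tp b; rewrite /psi.
have -> : t (E (b, 0%R)) = E ((b + 1)%R, 0%R).
  by rewrite !EE !mulg1 expg_Fp // expg1 permM.
by rewrite EK.
Qed.
End Coordinates.

Local Open Scope ring_scope.

(** * Finite differences over the prime field *)

Section PrimeField.
Variable p : nat.
Hypothesis p_pr : prime p.
Implicit Types (f g : 'F_p -> 'F_p) (a b x y : 'F_p).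

Lemma Fp_ind (P : 'F_p -> Prop) :
  P 0 -> (forall x, P x -> P (x + 1)) -> forall x, P x.
Proof.
move=> P0 PS x; rewrite -[x]natr_Zp.
by elim: (x : nat) => [|n IH] //; rewrite -addn1 natrD; apply: PS.
Qed.

Lemma Fp2_cases x : p = 2%N -> x = 0 \/ x = 1.
Proof.
move=> p2; have two0 : 1 + 1 = 0 :> 'F_p by rewrite -(pchar_Fp_0 p_pr) p2.
by elim/Fp_ind: x => [|x [->|->]]; [left | right; rewrite add0r | left].
Qed.

Lemma Fp_two_neq0 : p != 2%N -> (2 : 'F_p) != 0.
Proof.
by rewrite -(dvdn_pcharf (pchar_Fp p_pr)) dvdn_prime2.
Qed.

Lemma affine_step f k L : k != 0 -> (forall x, f (x + k) = f x + L) ->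
  forall x, f x = f 0 + L / k * x.
Proof.
move=> k0 fk x; have -> : x = k * (x / k) by field.
elim/Fp_ind: (x / k) => [|z IH]; first by rewrite !mulr0 addr0.
by rewrite mulrDr mulr1 fk IH; field.
Qed.

Lemma periodic_const (T : Type) (f : 'F_p -> T) k : k != 0 ->
  (forall x, f (x + k) = f x) -> forall x, f x = f 0.
Proof.
move=> k0 fk x; have -> : x = k * (x / k) by field.
elim/Fp_ind: (x / k) => [|z IH]; first by rewrite mulr0.
by rewrite mulrDr mulr1 fk.
Qed.

Lemma diagonal_periodic (T : Type) (h : 'F_p -> 'F_p -> T) :
  (forall a b, h (a + 1) (b + 1) = h a b) -> forall a b, h a b = h 0 (b - a).
Proof.
move=> hS a; elim/Fp_ind: a => [|a IH] b; first by rewrite subr0.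
by rewrite -[b in LHS](subrK 1) hS IH; congr h; ring.
Qed.

Definition diff f x := f (x + 1) - f x.

Lemma eq_diff n f g : f =1 g -> iter n diff f =1 iter n diff g.
Proof. by move=> eq_fg; elim: n => //= n IH x; rewrite /diff !IH. Qed.

Lemma diff_shift n f s x : iter n diff (fun y => f (y + s)) x = iter n diff f (x + s).
Proof. by elim: n x => //= n IH x; rewrite /diff !IH addrAC. Qed.

Lemma diff_sub n f g x :
  iter n diff (fun y => f y - g y) x = iter n diff f x - iter n diff g x.
Proof. by elim: n x => //= n IH x; rewrite /diff !IH; ring. Qed.

Lemma diff_scale n k f x : iter n diff (fun y => k * f y) x = k * iter n diff f x.
Proof. by elim: n x => //= n IH x; rewrite /diff !IH; ring. Qed.

Lemma diff0 n x : iter n diff (fun=> 0) x = 0.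
Proof. by elim: n x => //= n IH x; rewrite /diff !IH subrr. Qed.

Lemma diff_exchange m n (h : 'F_p -> 'F_p -> 'F_p) x y :
  iter m diff (fun x => iter n diff (h x) y) x =
  iter n diff (fun y => iter m diff (fun x => h x y) x) y.
Proof.
elim: m x => //= m IH x; rewrite /diff !IH -diff_sub.
by apply: eq_diff => z.
Qed.

Lemma newton n f x : f (x + n%:R) = \sum_(i < n.+1) iter i diff f x *+ 'C(n, i).
Proof.
elim: n x => [|n IH] x; first by rewrite big_ord1 addr0.
have -> : x + n.+1%:R = (x + 1) + n%:R by rewrite -natr1; ring.
rewrite IH.
have step i : iter i diff f (x + 1) = iter i.+1 diff f x + iter i diff f x.
  by rewrite iterS /diff subrK.
under eq_bigr do rewrite step mulrnDl.
rewrite big_split /= [X in _ + X]big_ord_recl [RHS]big_ord_recl /= !bin0.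
under [X in _ = _ + X]eq_bigr do rewrite /bump /= add1n binS mulrnDr.
rewrite big_split /= [X in _ = _ + (X + _)]big_ord_recr /= bin_small // mulr0n addr0.
by rewrite addrCA; congr (_ + _); rewrite addrC.
Qed.

(** In the Newton expansion at [n = p] the middle binomials vanish mod p and [x + p] is [x]. Every
    function on ['F_p] thus has degree below p. *)
Lemma diff_nilpotent f x : iter p diff f x = 0.
Proof.
have := newton p f x; rewrite pchar_Fp_0 // addr0 big_ord_recr /=.
rewrite (bigD1 (Ordinal (prime_gt0 p_pr))) //= bin0 binn big1 ?addr0 => [|i i0].
  by move/eqP; rewrite -subr_eq0 opprD addrA subrr sub0r oppr_eq0 => /eqP.
have /(prime_dvd_bin p_pr)/dvdnP[k ->] : (0 < i < p)%N by rewrite lt0n i0 ltn_ord.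
by rewrite -mulr_natr natrM pchar_Fp_0 // !mulr0.
Qed.

(* A family which solves this equation is constant in y: at the maximal
   degree d of the members, d differences in x and d - 1 differences in y leave
   the product of the leading coefficients of f b and f (a - b) on the left and 0
   on the right. *)
Lemma symmetric_shift_const (f : 'F_p -> 'F_p -> 'F_p) :
    (forall a b x y, f b (y + f (a - b) x) - f b y = f a (x + f (b - a) y) - f a x) ->
  forall b y, f b y = f b 0.
Proof.
move=> fE.
have ex_d : exists d, [forall b, forall y, iter d diff (f b) y == 0].
  by exists p; apply/forallP=> b; apply/forallP=> y; rewrite diff_nilpotent.
case: (ex_minnP ex_d) => d /forallP-d0 d_min.
have {}d0 b y : iter d diff (f b) y = 0 by apply/eqP/(forallP (d0 b)).
case: d => [|[|d]] in d0 d_min *.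
- have f0 b y : f b y = 0 := d0 b y.
  by move=> b y; rewrite !f0.
- move=> b y; apply: (@periodic_const _ (f b) 1); rewrite ?oner_eq0 // => {}y.
  by apply/eqP; rewrite -subr_eq0; apply/eqP/(d0 b).
(* The minimal order of vanishing is now [d.+2], so the maximal degree is [d.+1] and [L b] is the
   coefficient of that degree in [f b], up to a factorial. *)
pose L b := iter d.+1 diff (f b) 0.
have LE b y : iter d.+1 diff (f b) y = L b.
  apply: (@periodic_const _ _ 1); rewrite ?oner_eq0 // => {}y.
  by apply/eqP; rewrite -subr_eq0; apply/eqP/(d0 b).
have LL a b : L b * L (a - b) = 0.
  pose lhs x y := f b (y + f (a - b) x) - f b y.
  transitivity (iter d.+1 diff (fun x => iter d diff (lhs x) 0) 0).
    rewrite /L -diff_scale; apply: eq_diff => x.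
    rewrite /lhs diff_sub diff_shift add0r -/(L b).
    rewrite (@affine_step (iter d diff (f b)) 1 (L b)) ?oner_eq0 // => [|y].
      by rewrite divr1; ring.
    by apply/eqP; rewrite [_ + L b]addrC -subr_eq; apply/eqP/(LE b y).
  rewrite diff_exchange -[RHS](diff0 d 0); apply: eq_diff => y.
  rewrite (eq_diff _ (g := fun x => f a (x + f (b - a) y) - f a x)) => [|x].
    by rewrite diff_sub diff_shift !LE subrr.
  exact: fE.
suff : (d.+2 <= d.+1)%N by rewrite ltnn.
apply: d_min; apply/forallP=> b; apply/forallP=> y; rewrite LE.
(* The choice [a = b + b] makes both factors equal to [L b]. *)
have := LL (b + b) b; rewrite addrK => /eqP.
by rewrite mulf_eq0 orbb.
Qed.
End PrimeField.

(** * Cycle sets with p-group permutation group *)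

Section BlockCycleSets.
Variable p : nat.
Hypothesis p_pr : prime p.
Notation F := 'F_p.
Variables (c : F * F -> F) (psi : F * F -> F -> F).
Let act (u v : F * F) : F * F := (v.1 + c u, v.2 + psi u v.1).
Hypothesis act_cycle :
  forall u v w, act (act u v) (act u w) = act (act v u) (act v w).

Let cycle1 u v : c u + c (act u v) = c v + c (act v u).
Proof. by have := congr1 fst (act_cycle u v (0, 0)); rewrite /= !add0r. Qed.

Let cycle2 u v b : psi u b + psi (act u v) (b + c u) = psi v b + psi (act v u) (b + c v).
Proof. by have := congr1 snd (act_cycle u v (b, 0)); rewrite /= !add0r. Qed.

(** The automorphism is the unit shift of the first coordinate. It turns the second component of the
    cycle law into the equation of [symmetric_shift_const]; the first component then says that the
    increment of [c (0, _)] along a nonzero value of [Phi] is the same everywhere, so [c] is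
    affine. *)
Lemma horizontal_automorphism :
    (forall a x, c (a + 1, x) = c (a, x)) ->
    (forall a x b, psi (a + 1, x) (b + 1) = psi (a, x) b) ->
    (exists u b, psi u b != 0) ->
  exists gamma delta (Phi : F -> F),
  [/\ forall a x, c (a, x) = gamma * x + delta,
      forall a x b, psi (a, x) b = Phi (b - a)
    & gamma != 0 -> forall t, Phi t = Phi (- t)].
Proof.
move=> cS psiS [[a0 x0] [b0 nz_psi]].
have cE a x : c (a, x) = c (0, x).
  by rewrite (@periodic_const p _ (fun a => c (a, x)) 1) ?oner_eq0.
have psiE a x b : psi (a, x) b = psi (0, x) (b - a).
  by rewrite (diagonal_periodic (h := fun a b => psi (a, x) b)).
pose f b y := psi (0, y) b.
have fE a b x y : f b (y + f (a - b) x) - f b y = f a (x + f (b - a) y) - f a x.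
  have := cycle2 (- a, x) (- b, y) 0; rewrite /act /= !(psiE (_ + _)) !(psiE (- _)).
  rewrite !cE !opprK !add0r.
  have -> : c (0, x) - (- b + c (0, x)) = b by ring.
  have -> : c (0, y) - (- a + c (0, y)) = a by ring.
  have -> : - b + a = a - b by ring.
  have -> : - a + b = b - a by ring.
  rewrite -/(f _ _) => eq_f.
  apply/eqP; rewrite subr_eq -addrA [- _ + _]addrC addrA eq_sym subr_eq; apply/eqP.
  by rewrite addrC -eq_f addrC.
have f_const := symmetric_shift_const p_pr fE.
pose Phi t := psi (0, 0) t.
have psiPhi a x b : psi (a, x) b = Phi (b - a) by rewrite psiE -/(f _ _) f_const.
have cPhi t x y : c (0, y + Phi t) - c (0, y) = c (0, x + Phi (- t)) - c (0, x).
  have := cycle1 (- t, x) (0, y); rewrite /act /= !psiPhi !(cE (_ + _)) cE.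
  rewrite sub0r opprK subr0 => eq_c; apply/eqP.
  rewrite subr_eq -addrA [- _ + _]addrC addrA eq_sym subr_eq; apply/eqP.
  by rewrite addrC -eq_c addrC.
pose t0 := b0 - a0; have nz_Phi : Phi t0 != 0 by rewrite -(psiPhi a0 x0 b0).
have [gamma cA] : exists gamma, forall x, c (0, x) = gamma * x + c (0, 0).
  exists ((c (0, Phi (- t0)) - c (0, 0)) / Phi t0) => x; rewrite addrC.
  apply: (@affine_step p (fun x => c (0, x)) _ _ nz_Phi) => y.
  by apply/eqP; rewrite [_ + (_ - _)]addrC -subr_eq (cPhi t0 0 y) add0r.
exists gamma, (c (0, 0)), Phi; split=> // [a x|g0 t]; first by rewrite cE cA.
have := cPhi t 0 0; rewrite !add0r !(cA (Phi _)) !addrK => /eqP.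
by rewrite (inj_eq (mulfI g0)) => /eqP.
Qed.

Section VerticalAutomorphism.
Variable theta : F -> F.
Hypothesis c_theta : forall a x, c (a, x + theta a) = c (a, x).
Hypothesis psi_theta : forall a x b,
  psi (a, x + theta a) b = psi (a, x) b + theta (b + c (a, x)) - theta b.

(** [theta] is the shift of the automorphism inside each block. Where [theta a] is nonzero,
    [c (a, _)] is periodic; where it vanishes, a nonzero [c] would make [theta] periodic and so
    zero. The first component of the cycle law is then the shift equation for a family without
    index. *)
Lemma vertical_automorphism_const :
    (exists b, theta b != 0) -> (exists u, c u != 0) ->
  exists2 c0, c0 != 0 & forall u, c u = c0.
Proof.
move=> [b0 nz_theta] [[a0 x0] nz_c].
have cE a x : c (a, x) = c (a, 0).
  have [th0|nz_a] := eqVneq (theta a) 0; last first.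
    exact: (@periodic_const p _ (fun x => c (a, x)) (theta a)).
  have c_eq0 y : c (a, y) = 0.
    apply: contra_neq_eq nz_theta => nz_cy.
    have per b : theta (b + c (a, y)) = theta b.
      have /esym/eqP := psi_theta a y b.
      by rewrite th0 addr0 -addrA -subr_eq0 addrAC subrr add0r subr_eq0 => /eqP.
    by rewrite (periodic_const nz_cy per) -(periodic_const nz_cy per a).
  by rewrite !c_eq0.
have c_const : forall b y : F, c (y, 0) = c (0, 0).
  apply: (@symmetric_shift_const p p_pr (fun _ y => c (y, 0))) => _ _ x y.
  have := cycle1 (x, 0) (y, 0); rewrite /act /= !(cE (_ + _)) => eq_c; apply/eqP.
  rewrite subr_eq -addrA [- _ + _]addrC addrA eq_sym subr_eq; apply/eqP.
  by rewrite addrC -eq_c addrC.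
by exists (c (a0, x0)) => // -[a x]; rewrite !cE !(c_const 0).
Qed.

(** The automorphism makes [psi] affine in [x] with slope [(theta (b + 1) - theta b) / theta a]; the
    cycle law then leaves only a constant [theta], hence slope 0. *)
Lemma vertical_automorphism_indep : (exists b, theta b != 0) ->
  (forall u, c u = 1) -> forall a x b, psi (a, x) b = psi (a, 0) b.
Proof.
move=> [b0 nz_b0] c1.
have nz_theta a : theta a != 0.
  apply: contra_neq nz_b0 => th0.
  have per b : theta (b + 1) = theta b.
    have /esym/eqP := psi_theta a 0 b.
    by rewrite th0 addr0 c1 -addrA -subr_eq0 addrAC subrr add0r subr_eq0 => /eqP.
  by rewrite (periodic_const (oner_neq0 _) per) -(periodic_const (oner_neq0 _) per a).
have psiA a x b : psi (a, x) b =
    psi (a, 0) b + (theta (b + 1) - theta b) / theta a * x.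
  apply: (@affine_step p (fun x => psi (a, x) b)) => // y.
  by rewrite psi_theta c1 addrA.
(* Hence theta^-1 is affine; as it has no zero, it is constant. *)
have harmonic a : (theta a)^-1 - 2 * (theta (a + 1))^-1 + (theta (a + 1 + 1))^-1 = 0.
  (* The two indices differ only in [x], so by the affine formula only [theta] at three consecutive
     points survives. *)
  have := cycle2 (a, 1) (a, 0) a; rewrite /act /= !c1.
  rewrite !(psiA (a + 1) (_ + _)) !(psiA a 1).
  move: (nz_theta a) (nz_theta (a + 1)) (nz_theta (a + 1 + 1)).
  set t0 := theta a; set t1 := theta (a + 1); set t2 := theta (a + 1 + 1).
  move=> nz0 nz1 nz2 /eqP; rewrite -subr_eq0 => /eqP eq0.
  transitivity (t2^-1 * 0); last by rewrite mulr0.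
  by rewrite -eq0; field; rewrite nz0 nz1.
pose eta a := (theta a)^-1.
have etaS a : eta (a + 1) - eta a = eta 1 - eta 0.
  have := @periodic_const p _ (fun a => eta (a + 1) - eta a) 1 (oner_neq0 _).
  rewrite add0r => -> // {}a.
  apply/eqP; rewrite -subr_eq0; apply/eqP; rewrite -(harmonic a) /eta; ring.
pose K := eta 1 - eta 0.
have etaA a : eta a = eta 0 + K * a.
  rewrite (@affine_step p eta 1 K) ?oner_neq0 ?divr1 // => b.
  by rewrite /K -(etaS b) [RHS]addrC subrK.
have K0 : K = 0.
  apply/eqP/negPn/negP=> nzK; have /eqP[] := invr_neq0 (nz_theta (- eta 0 / K)).
  by rewrite -/(eta _) etaA; field.
have theta_const b : theta b = theta 0.
  by apply: invr_inj; rewrite -!/(eta _) etaA K0 mul0r addr0.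
by move=> a x b; rewrite psiA !theta_const subrr !mul0r addr0.
Qed.

End VerticalAutomorphism.

Lemma unit_shift_diagonal (Psi : F -> F -> F) :
    (forall u, c u = 1) -> (forall a x b, psi (a, x) b = Psi a b) ->
  forall a b, Psi a b = Psi b b + (Psi (a - b) 0 - Psi 0 0).
Proof.
move=> c1 psiE a b.
pose h b a := Psi a b - Psi b b.
have hS b' a' : h (b' + 1) (a' + 1) = h b' a'.
  have := cycle2 (a', 0) (b', 0) b'; rewrite /act /= !c1 !psiE /h => eq_psi.
  apply/eqP; rewrite eq_sym -subr_eq0 -(subrr (Psi b' b' + Psi (a' + 1) (b' + 1))).
  rewrite -{1}eq_psi.
  by apply/eqP; ring.
have := diagonal_periodic hS b a; rewrite /h => <-; ring.
Qed.
End BlockCycleSets.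

(** On a cyclic group a function is a coboundary up to its total sum, which is [S] and is placed at
    0. The partial sums [s] start with [n 1], so the jump of [g] lies between 0 and 1. *)
Lemma coboundary_correction (p : nat) (n : 'F_p -> 'F_p) : prime p ->
  exists (g : 'F_p -> 'F_p) (S : 'F_p), forall b, n b + g (b + 1) - g b = chi0 b * S.
Proof.
move=> p_pr.
pose s m : 'F_p := \sum_(i < m) n (i.+1)%:R.
have p_gt0 := prime_gt0 p_pr.
exists (fun b => - s (b - 1 : 'F_p)), (n 0 + s p.-1) => b.
rewrite /chi0 addrK; have [->|b0] := eqVneq b 0.
  rewrite sub0r; have -> : (- 1 : 'F_p) = p.-1 :> nat.
    have -> : - 1 = p.-1%:R :> 'F_p.
      by apply/eqP; rewrite eq_sym -subr_eq0 opprK natr1 prednK // pchar_Fp_0.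
    by rewrite val_Fp_nat // modn_small // prednK.
  by rewrite /s big_ord0 oppr0 addr0 opprK mul1r.
pose m : nat := (b - 1 : 'F_p)%R; have def_b : b = m.+1%:R.
  by rewrite -natr1 natr_Zp subrK.
have val_b : (b : nat) = m.+1.
  rewrite def_b val_Fp_nat // modn_small // ltn_neqAle.
  have -> : (m < p)%N by rewrite -[X in (_ < X)%N](Fp_cast p_pr) ltn_ord.
  by rewrite andbT; apply: contra_neq b0 => mp; rewrite def_b mp pchar_Fp_0.
by rewrite mul0r val_b -/m /s big_ord_recr /= -def_b; ring.
Qed.

Section BlockCoordinates.
Variables (p : nat) (X : finType) (s : X -> {perm X}).
Hypothesis p_pr : prime p.
Notation F := 'F_p.

Definition block_coordinates (E : F * F -> X) (c : F * F -> F) (psi : F * F -> F -> F) :=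
  bijective E /\ forall u b y, s (E u) (E (b, y)) = E (b + c u, y + psi u b).

Section Fixed.
Variables (E : F * F -> X) (c : F * F -> F) (psi : F * F -> F -> F).
Hypothesis sC : cycle_set s.
Hypothesis trs : [transitive gens s, on setT | 'P].
Hypothesis Ec : block_coordinates E c psi.

Lemma block_cycle : let act (u v : F * F) := (v.1 + c u, v.2 + psi u v.1) in
  forall u v w, act (act u v) (act u w) = act (act v u) (act v w).
Proof.
have [E_bij sE] := Ec; move=> act u v w; apply: (bij_inj E_bij).
have actE u' v' : E (act u' v') = s (E u') (E v') by case: v' => b y; rewrite sE.
by rewrite !actE -!permM sC.
Qed.

Lemma block_shift_neq0 : exists u, c u != 0.
Proof.
have [E_bij sE] := Ec; have [E' EK E'K] := E_bij.
suff /existsP[u nz] : [exists u, c u != 0] by exists u.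
apply: contraT => /existsPn c0.
have := @transitive_stable _ _ (fun x => (E' x).1 == 0) (E (0, 0)) trs.
rewrite EK /= eqxx => /(_ _ erefl (E (1, 0))); rewrite EK /= oner_eq0; apply=> u y.
rewrite -{2}[y]E'K -[u]E'K.
case: (E' y) => b w /= /eqP ->; rewrite sE EK /=.
by have := c0 (E' u); rewrite negbK add0r.
Qed.

Lemma block_psi_neq0 : exists u b, psi u b != 0.
Proof.
have [E_bij sE] := Ec; have [E' EK E'K] := E_bij.
suff /existsP[u /existsP[b nz]] : [exists u, exists b, psi u b != 0] by exists u, b.
apply: contraT => /existsPn psi0.
have := @transitive_stable _ _ (fun x => (E' x).2 == 0) (E (0, 0)) trs.
rewrite EK /= eqxx => /(_ _ erefl (E (0, 1))); rewrite EK /= oner_eq0; apply=> u y.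
rewrite -{2}[y]E'K -[u]E'K.
case: (E' y) => b w /= /eqP ->; rewrite sE EK /=.
by have /existsPn/(_ b) := psi0 (E' u); rewrite negbK add0r.
Qed.
End Fixed.

Lemma bijective_change (E : F * F -> X) (f g : F * F -> F * F) :
  bijective E -> cancel f g -> bijective (E \o f).
Proof. by move=> bE fK; apply: bij_comp => //; apply: injF_bij; apply: can_inj fK. Qed.

Lemma block_rescale E k c psi :
    block_coordinates E c psi -> k != 0 -> (forall u, c u = k) ->
  block_coordinates (fun u => E (k * u.1, u.2)) (fun=> 1)
    (fun u b => psi (k * u.1, u.2) (k * b)).
Proof.
move=> [E_bij sE] k0 ck; split.
  apply: (bijective_change (g := fun u => (u.1 / k, u.2)) E_bij) => -[a x] /=.
  by congr (_, _); field.
by move=> u b y; rewrite sE ck /=; congr (E (_, _)); ring.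
Qed.

Definition translation_coordinates E (Psi : F -> F -> F) :=
  bijective E /\
  forall a x b y, s (E (a, x)) (E (b, y)) = E (b + 1, y + Psi a b).

Definition scaling_coordinates E (Phi : F -> F) :=
  [/\ bijective E, nonconstant Phi, forall t, Phi t = Phi (- t) &
      forall a x b y, s (E (a, x)) (E (b, y)) = E (b + x, y + Phi (b - a))].

Lemma rescale_translation E c psi k (Psi : F -> F -> F) :
    block_coordinates E c psi -> k != 0 -> (forall u, c u = k) ->
    (forall a x b, psi (a, x) b = Psi a b) ->
  exists E' Psi', translation_coordinates E' Psi'.
Proof.
move=> Ec k0 ck psiE; have [E'_bij sE'] := block_rescale Ec k0 ck.
by eexists _, (fun a b => Psi (k * a) (k * b)); split; first exact: E'_bij;
  move=> a x b y; rewrite sE' psiE.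
Qed.

Lemma prime_square_coordinates :
    cycle_set s -> (p.-group (gens s))%g -> [transitive gens s, on setT | 'P] ->
    #|X| = (p ^ 2)%N ->
    (exists z, [/\ z \in gens s, #[z] = p & forall u, s u * z = z * s (z u)])%g ->
  (exists E Psi, translation_coordinates E Psi) \/
  (exists E Phi, scaling_coordinates E Phi).
Proof.
move=> sC pP trP cardX [z [Pz oz autz]].
have zp : (z ^+ p = 1)%g by rewrite -oz expg_order.
have [c [cM [t1 Pt1 ct1] coord]] := exists_coordinates p_pr pP cardX trP.
have Ps u : s u \in gens s by rewrite mem_gen ?imset_f.
have c_aut g u : g \in gens s -> (s u * g = g * s (g u))%g -> c (s (g u)) = c (s u).
  move=> Pg /(congr1 c); rewrite !cM // addrC => /addrI-> //.
have [cz0|cz0] := eqVneq (c z) 0.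
  have [E [psi [E_bij hE _]]] := coord t1 Pt1 ct1.
  have Ec : block_coordinates E (fun u => c (s (E u))) (fun u => psi (s (E u))).
    by split=> // u b y; rewrite hE.
  have zE b y : z (E (b, y)) = E (b, y + psi z b) by rewrite hE // cz0 addr0.
  have nz_theta : exists b, psi z b != 0.
    apply/existsP; apply: contraT => /existsPn th0; case/eqP: (oner_neq0 'F_p).
    suff z1 : z = 1%g.
      by move: (prime_gt1 p_pr); rewrite -oz z1 order1.
    apply/permP=> x; rewrite perm1; have [E' _ E'K] := E_bij.
    rewrite -[x]E'K; case: (E' x) => b y; rewrite zE.
    by have := th0 b; rewrite negbK => /eqP->; rewrite addr0.
  have c_theta a x : c (s (E (a, x + psi z a))) = c (s (E (a, x))).
    by rewrite -zE c_aut.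
  have psi_theta a x b : psi (s (E (a, x + psi z a))) b =
      psi (s (E (a, x))) b + psi z (b + c (s (E (a, x)))) - psi z b.
    have := congr1 (fun g : {perm X} => g (E (b, 0))) (autz (E (a, x))).
    rewrite /= !permM hE // !zE hE // => /(bij_inj E_bij)/(congr1 snd) /=.
    rewrite !add0r => ->; ring.
  have [k k0 ck] := vertical_automorphism_const p_pr (block_cycle sC Ec)
    c_theta psi_theta nz_theta (block_shift_neq0 trP Ec).
  have Ec' := block_rescale Ec k0 ck.
  left; apply: (rescale_translation (k := 1) Ec') => //; rewrite ?oner_neq0 //.
  move=> a x b /=.
  have [b0 nz_b0] := nz_theta.
  apply: (vertical_automorphism_indep (block_cycle sC Ec')
    (theta := fun b => psi z (k * b))) => //.
  - by move=> {}a {}x {}b /=; rewrite psi_theta ck; congr (_ + psi z _ - _); ring.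
  by exists (b0 / k); have -> : k * (b0 / k) = b0 by field.
(* This power is again an automorphism but shifts blocks by exactly 1; as [t ^+ p] is 1, the
   coordinates built on it make [psi t] vanish. *)
pose t := (z ^+ (c z)^-1%R)%g.
have Pt : t \in gens s by rewrite groupX.
have cX n : c (z ^+ n)%g = c z *+ n.
  elim: n => [|n IH]; last by rewrite expgS cM ?groupX // IH mulrS.
  apply/esym/(addrI (c 1%g)).
  by rewrite addr0 -{1}[1%g]mulg1 cM.
have ct : c t = 1 by rewrite cX -mulr_natr natr_Zp divff.
have tp : (t ^+ p = 1)%g by rewrite -expgM mulnC expgM zp expg1n.
have autt u : (s u * t = t * s (t u))%g.
  rewrite /t; elim: (nat_of_ord _) u => [|n IH] u; first by rewrite mulg1 mul1g perm1.
  by rewrite expgS permM -mulgA -IH !mulgA autz.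
have [E [psi [E_bij hE psit]]] := coord t Pt ct.
have tE b y : t (E (b, y)) = E (b + 1, y) by rewrite hE // ct psit // addr0.
have Ec : block_coordinates E (fun u => c (s (E u))) (fun u => psi (s (E u))).
  by split=> // u b y; rewrite hE.
have cS a x : c (s (E (a + 1, x))) = c (s (E (a, x))) by rewrite -tE c_aut.
have psiS a x b : psi (s (E (a + 1, x))) (b + 1) = psi (s (E (a, x))) b.
  have := congr1 (fun g : {perm X} => g (E (b, 0))) (autt (E (a, x))).
  rewrite /= !permM hE // !tE hE // => /(bij_inj E_bij)/(congr1 snd) /=.
  by rewrite !add0r.
have [gamma [delta [Phi [cE psiE Phi_even]]]] :=
  horizontal_automorphism p_pr (block_cycle sC Ec) cS psiS (block_psi_neq0 trP Ec).
have sE a x b y : s (E (a, x)) (E (b, y)) = E (b + (gamma * x + delta), y + Phi (b - a)).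
  by have [_ ->] := Ec; rewrite cE psiE.
have [g0|g0] := eqVneq gamma 0.
  have [[a0 x0] nz_c] := block_shift_neq0 trP Ec.
  left; apply: (rescale_translation Ec (k := delta) _ _ psiE).
    by move: nz_c; rewrite /= cE g0 mul0r add0r.
  by case=> a x /=; rewrite cE g0 mul0r add0r.
have [Phi_const|Phi_nc] := boolP [forall t, Phi t == Phi 0].
  have {}Phi_const t' : Phi t' = Phi 0 by apply/eqP/(forallP Phi_const).
  have [[a0 x0] [b0 nz]] := block_psi_neq0 trP Ec.
  move: nz; rewrite /= psiE Phi_const => kappa0.
  (* With [Phi] constant the second coordinate moves by a fixed nonzero step, so the coordinates
     trade places. *)
  left; exists (fun u => E (u.2, Phi 0 * u.1)).
  exists (fun a _ => gamma * (Phi 0 * a) + delta); split.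
    apply: (bijective_change (g := fun u => (u.2 / Phi 0, u.1)) E_bij) => -[a x] /=.
    by congr (_, _); field.
  move=> a x b y; rewrite sE Phi_const /=; congr (E (_, _)); ring.
right; exists (fun u => E (u.1, (u.2 - delta) / gamma)), (fun x => gamma * Phi x); split.
- apply: (bijective_change (g := fun u => (u.1, gamma * u.2 + delta)) E_bij) => -[a x] /=.
  by congr (_, _); field.
- move=> [k Phi_k]; case/negP: Phi_nc; apply/forallP=> x.
  by rewrite -(inj_eq (mulfI g0)) !Phi_k.
- by move=> x; rewrite -Phi_even.
move=> a x b y; rewrite sE /=; congr (E (_, _)); field => //.
Qed.

End BlockCoordinates.

(** * The complement of the Sylow p-subgroup *)

(* The case p = 2 of the scaling coordinates, with bool for F_2. *)
Lemma no_cubic_automorphism_bool (f : bool * bool -> bool * bool) (phi : bool -> bool) u :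
    phi true != phi false -> (forall w, f (f (f w)) = w) ->
    (forall w, f (w.1 (+) u.2, w.2 (+) phi (w.1 (+) u.1)) =
       ((f w).1 (+) (f u).2, (f w).2 (+) phi ((f w).1 (+) (f u).1))) ->
  forall w, f w = w.
Proof.
pose lk (a b c d : bool * bool) (w : bool * bool) :=
  if w.1 then (if w.2 then d else c) else (if w.2 then b else a).
pose ph (s t x : bool) := if x then s else t.
pose all4 (P : pred (bool * bool)) :=
  [&& P (false, false), P (false, true), P (true, false) & P (true, true)].
(* A Boolean test on the four values of [f], the two values of [phi] and the point [u]; all cases
   are checked by computation. *)
pose check a b c d s t v := let g := lk a b c d in let q := ph s t in
  [==> s != t, all4 (fun w => g (g (g w)) == w),
    all4 (fun w => g (w.1 (+) v.2, w.2 (+) q (w.1 (+) v.1)) ==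
       ((g w).1 (+) (g v).2, (g w).2 (+) q ((g w).1 (+) (g v).1)))
    => all4 (fun w => g w == w)].
have checkT a b c d s t v : check a b c d s t v.
  by case: a b c d s t v => [[] []] [[] []] [[] []] [[] []] [] [] [[] []].
have all4P (P : pred (bool * bool)) : reflect (forall w, P w) (all4 P).
  apply: (iffP idP); first by move=> /and4P[P1 P2 P3 P4] [[] []].
  by move=> P4; apply/and4P.
have fE w : f w =
    lk (f (false, false)) (f (false, true)) (f (true, false)) (f (true, true)) w.
  by case: w => [[] []].
have phE x : phi x = ph (phi true) (phi false) x by case: x.
move=> phi_nc f3 fu w; rewrite fE; apply/eqP; move: w; apply/all4P.
have /implyP/(_ phi_nc)/implyP chk := checkT (f (false, false)) (f (false, true))
  (f (true, false)) (f (true, true)) (phi true) (phi false) u.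
apply: (implyP (chk _)); apply/all4P=> w; rewrite -!fE -?phE; first by rewrite f3.
by rewrite fu.
Qed.

Section ScalingComplement.
Variables (p : nat) (X : finType) (s1 s2 : X -> {perm X}).
Hypothesis p_pr : prime p.
Notation F := 'F_p.
Let P := gens s1.
Let Q := gens s2.
Hypothesis trP : [transitive P, on setT | 'P].
Hypothesis p'Q : (p^'.-group Q)%g.
Hypothesis conjQ : forall u tau, tau \in Q -> ((s1 u)^-1 * tau * s1 (tau u) \in Q)%g.
Hypothesis compat : forall u v, (s1 u * s2 (s1 u v) = s2 v * s1 (s2 v u))%g.
Variables (E : F * F -> X) (Phi : F -> F).
Hypothesis E_bij : bijective E.
Hypothesis Phi_nc : nonconstant Phi.
Hypothesis Phi_even : forall t, Phi t = Phi (- t).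
Hypothesis s1E : forall a x b y, s1 (E (a, x)) (E (b, y)) = E (b + x, y + Phi (b - a)).

Let E_inj := bij_inj E_bij.

Definition block_preserving (g : {perm X}) :=
  exists A (B : F -> F -> F), forall b y, g (E (b, y)) = E (A b, B b y).

(** Iterating [#|Q|] times adds [k *+ #|Q|], which must vanish although [#|Q|] is prime to p. *)
Lemma coprime_shift (pi : X -> F) g k :
  g \in Q -> (forall x, pi (g x) = pi x + k) -> k = 0.
Proof.
move=> Qg gE; have gX n x : pi ((g ^+ n)%g x) = pi x + k *+ n.
  elim: n x => [|n IH] x; first by rewrite perm1 addr0.
  by rewrite expgSr permM gE IH mulrSr addrA.
have := gX #|Q| (E (0, 0)); rewrite expg_cardG // perm1 => /eqP.
rewrite addrC -subr_eq subrr eq_sym -mulr_natr mulf_eq0 => /orP[/eqP //|].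
rewrite -(dvdn_pcharf (pchar_Fp p_pr)) => pQ.
by have := p'Q; rewrite /pgroup p'natE // pQ.
Qed.

(** Comparing compatibility at an index and at its reflection about the block [b0] of [v] gives
    periods of [A b], one of them nonzero if [b != b0]. The block [b0] itself is settled by
    counting. *)
Lemma odd_block_preserving v : p != 2%N -> block_preserving (s2 v).
Proof.
move=> p_odd; have [E' EK E'K] := E_bij.
have two_nz := Fp_two_neq0 p_pr p_odd.
set D := s2 v.
pose A b y := (E' (D (E (b, y)))).1; pose B b y := (E' (D (E (b, y)))).2.
have DE b y : D (E (b, y)) = E (A b y, B b y).
  by rewrite /A /B -surjective_pairing E'K.
case def_v: (E' v) => [b0 w0]; have {}def_v : v = E (b0, w0) by rewrite -def_v E'K.
have key a x b y : s2 (E (b0 + x, w0 + Phi (b0 - a))) (E (b + x, y + Phi (b - a))) =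
    E (A b y + B a x, B b y + Phi (A b y - A a x)).
  have := congr1 (fun g : {perm X} => g (E (b, y))) (compat (E (a, x)) v).
  by rewrite /= !permM -/D !DE !s1E def_v s1E.
(* s1 (E (a, x)) v is unchanged when a is reflected about b0. *)
have Bsym e x : B (b0 + e) x = B (b0 - e) x.
  have := key (b0 + e) x b0 0; have := key (b0 - e) x b0 0.
  have -> : b0 - (b0 + e) = - e by ring.
  have -> : b0 - (b0 - e) = e by ring.
  by rewrite -Phi_even => -> /E_inj/(congr1 fst)/addrI ->.
have Aper e b y : A b (y + (Phi (b - b0 - e) - Phi (b - b0 + e))) = A b y.
  have := key (b0 + e) 0 b y.
  have := key (b0 - e) 0 b (y + (Phi (b - b0 - e) - Phi (b - b0 + e))).
  have -> : b0 - (b0 + e) = - e by ring.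
  have -> : b0 - (b0 - e) = e by ring.
  have -> : b - (b0 + e) = b - b0 - e by ring.
  have -> : b - (b0 - e) = b - b0 + e by ring.
  by rewrite -Phi_even addrA subrK => -> /E_inj/(congr1 fst) /=; rewrite (Bsym e) => /addIr.
have A_off b y : b != b0 -> A b y = A b 0.
  move=> nb; have nz_t : b - b0 != 0 by rewrite subr_eq0.
  (* If all these periods were 0, [Phi] would have period [2 * (b - b0)] and be constant. *)
  have [/forallP per|/forallPn[e ne]] :=
    boolP [forall e, Phi (b - b0 - e) == Phi (b - b0 + e)].
    case: Phi_nc; exists (Phi 0); apply: (@periodic_const _ _ _ (2 * (b - b0))).
      by rewrite mulf_neq0.
    move=> x; have /eqP := per (x + (b - b0)).
    by rewrite Phi_even => eqx; symmetry; etransitivity; [|etransitivity; [exact: eqx|]];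
      congr Phi; ring.
  by apply: (@periodic_const _ _ (A b) _ _ (Aper e b)); rewrite subr_eq0.
have D_inj b y b' y' : A b y = A b' y' -> B b y = B b' y' -> b = b'.
  move=> eA eB; have eD : D (E (b, y)) = D (E (b', y')) by rewrite !DE eA eB.
  by have := congr1 fst (E_inj (perm_inj eD)).
have A_new b y b' : b != b0 -> b' != b -> A b' y != A b 0.
  move=> nb nb'; apply/eqP=> eA.
  have B_bij : bijective (B b).
    apply: injF_bij => z z' eqB.
    have eD : D (E (b, z)) = D (E (b, z')).
      by rewrite !DE (A_off b z) // (A_off b z') // eqB.
    by have := congr1 snd (E_inj (perm_inj eD)).
  have [B' _ B'K] := B_bij.
  by case/eqP: nb'; apply: (@D_inj b' y b (B' (B b' y)));
    [rewrite (A_off b) | rewrite B'K].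
exists (fun b => A b 0), B => b y; rewrite DE; congr (E (_, _)).
have [{b}->|/A_off//] := eqVneq b b0.
(* One value per block, with height [y] used in block [b0]: being injective, [h] is onto, and it can
   take the value [A b0 0] only at [b0]. *)
pose h b := if b == b0 then A b0 y else A b 0.
have h_inj : injective h.
  move=> b b'; rewrite /h.
  case: (eqVneq b b0) => [->|nb]; case: (eqVneq b' b0) => [->|nb'] //.
  - by move=> eA; case/eqP: (A_new b' y b0 nb' (contra_neq esym nb')).
  - by move=> eA; case/eqP: (A_new b y b0 nb (contra_neq esym nb)).
  by move=> eA; apply/eqP; apply: contraT => nbb'; case/eqP: (A_new b' 0 b nb' nbb').
have [h' _ h'K] := injF_bij h_inj.
have := h'K (A b0 0); rewrite {1}/h; case: eqVneq => // nb eA.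
by case/eqP: (A_new _ 0 b0 nb (contra_neq esym nb)).
Qed.

(** On four points a permutation of odd order has cube 1. A block [a] with [Phi (b0 - a) = 0] makes
    [s1 (E (a, 0))] fix [v], so compatibility becomes an intertwining relation, which leaves only
    the identity. *)
Lemma even_complement v : p = 2%N -> s2 v = 1%g.
Proof.
move=> p2; have [E' EK E'K] := E_bij.
have cardX : #|X| = 4.
  by rewrite -(bij_eq_card E_bij) card_prod card_Fp // p2.
set tau := s2 v; have Qtau : tau \in Q by rewrite mem_gen ?imset_f.
have tau3 : (tau ^+ 3 = 1)%g.
  apply/eqP; rewrite -order_dvdn.
  have p'tau : p^'.-nat #[tau]%g := mem_p_elt p'Q Qtau.
  have : (#[tau]%g %| 2 ^ 3 * 3)%N.
    have -> : (2 ^ 3 * 3 = #|[set: {perm X}]|)%N.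
      transitivity (#|X|`!)%N; first by rewrite cardX.
      rewrite -cardsT -card_perm; apply: eq_card => g.
      by rewrite inE; apply/subsetP=> x; rewrite inE.
    by apply: order_dvdG; rewrite inE.
  rewrite Gauss_dvdr // coprimeXr // coprimen2 odd_2'nat.
  by rewrite -p2.
pose h (x : bool) : F := x%:R; pose h' (x : F) := x != 0.
have two0 : (2 : F) = 0 by rewrite -p2 pchar_Fp_0.
have F2 x := @Fp2_cases p p_pr x p2.
have hK : cancel h h' by case; rewrite /h /h' ?oner_eq0 ?eqxx.
have h'K : cancel h' h.
  by move=> x; rewrite /h /h'; case: (F2 x) => ->; rewrite ?oner_eq0 ?eqxx.
have hD x y : h (x (+) y) = h x + h y.
  by case: x y => [] []; rewrite /h /= ?addr0 ?add0r // two0.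
have h'D x y : h' (x + y) = h' x (+) h' y by rewrite -{1}[x]h'K -{1}[y]h'K -hD hK.
have hN (x : F) : - x = x.
  by apply/eqP; rewrite eq_sym -subr_eq0 opprK -mulr2n -mulr_natr two0 mulr0.
pose H (w : bool * bool) := E (h w.1, h w.2).
pose H' x := (h' (E' x).1, h' (E' x).2).
have HK : cancel H H' by case=> x y; rewrite /H /H' EK /= !hK.
have H'K : cancel H' H.
  by move=> x; rewrite /H /H' /= !h'K -surjective_pairing E'K.
pose phi x := h' (Phi (h x)).
have phi_nc : phi true != phi false.
  apply/eqP=> /(can_inj h'K) eqPhi; case: Phi_nc; exists (Phi 0) => x.
  by case: (F2 x) => ->.
case def_v: (E' v) => [b0 w0]; have {}def_v : v = E (b0, w0) by rewrite -def_v E'K.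
have [a Phi_a] : exists a, Phi (b0 - a) = 0.
  have [Phi0|Phi0] := F2 (Phi 0); first by exists b0; rewrite subrr.
  have [Phi1|Phi1] := F2 (Phi 1).
    by exists (b0 - 1); rewrite opprB addrCA subrr addr0.
  by case: Phi_nc; exists 1 => x; case: (F2 x) => ->.
have s1v : s1 (E (a, 0)) v = v by rewrite def_v s1E Phi_a !addr0.
have eq_tau x : tau (s1 (E (a, 0)) x) = s1 (tau (E (a, 0))) (tau x).
  by rewrite -!permM -compat s1v.
have s1H w u : H' (s1 (H u) (H w)) = (w.1 (+) u.2, w.2 (+) phi (w.1 (+) u.1)).
  by rewrite /H s1E /H' EK /= !h'D !hK /phi hD hN.
pose f w := H' (tau (H w)); pose u := H' (E (a, 0)).
have f3 w : f (f (f w)) = w.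
  rewrite /f !H'K -{2}[w]HK; congr H'.
  have := congr1 (fun g : {perm X} => g (H w)) tau3.
  by rewrite perm1 !expgS expg0 mulg1 !permM.
have f_hom w : f (H' (s1 (H u) (H w))) = H' (s1 (H (f u)) (H (f w))).
  by rewrite /f /u !H'K eq_tau.
have fixH w : f w = w.
  apply: (no_cubic_automorphism_bool (u := u) phi_nc f3) => {}w.
  by rewrite -!s1H f_hom.
by apply/permP=> x; rewrite perm1 -[x]H'K -[tau _]H'K -/(f _) fixH.
Qed.

Lemma complement_block_preserving tau : tau \in Q -> block_preserving tau.
Proof.
pose bp := [set g : {perm X} | [exists A : {ffun F -> F}, exists B : {ffun F * F -> F},
  forall b, forall y, g (E (b, y)) == E (A b, B (b, y))]].
have bpP g : reflect (block_preserving g) (g \in bp).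
  rewrite inE; apply: (iffP existsP) => [[A /existsP[B AB]]|[A [B AB]]].
    exists A, (fun b y => B (b, y)) => b y; apply/eqP.
    by have /forallP/(_ y) := forallP AB b.
  exists [ffun b => A b]; apply/existsP; exists [ffun u => B u.1 u.2].
  by apply/forallP=> b; apply/forallP=> y; rewrite !ffunE AB.
have gbp : group_set bp.
  apply/group_setP; split=> [|g h /bpP[A [B gE]] /bpP[A' [B' hE]]].
    by apply/bpP; exists id, (fun=> id) => b y; rewrite perm1.
  apply/bpP; exists (A' \o A), (fun b y => B' (A b) (B b y)) => b y.
  by rewrite permM gE hE.
suff sQ : Q \subset Group gbp by move/(subsetP sQ)/bpP.
rewrite gen_subG; apply/subsetP=> _ /imsetP[v _ ->]; apply/bpP.
have [p2|] := eqVneq p 2%N; last exact: odd_block_preserving.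
by exists id, (fun=> id) => b y; rewrite even_complement // perm1.
Qed.

Let twist tau a x := ((s1 (E (a, x)))^-1 * tau * s1 (tau (E (a, x))))%g.

(** [twist tau a x] and [twist tau 0 x] lie in [Q] and act on first coordinates alike up to a
    constant. By [coprime_shift] the constant is 0, so the height of an image under [tau] does not
    depend on the block. *)
Lemma complement_split tau : tau \in Q ->
  exists A B : F -> F,
  [/\ forall b y, tau (E (b, y)) = E (A b, B y), B 0 = 0
    & forall a x b y, twist tau a x (E (b + x, y + Phi (b - a))) =
        E (A b + B x, B y + Phi (A b - A a))].
Proof.
move=> Qtau; have [E' EK E'K] := E_bij.
have [A [B tauE]] := complement_block_preserving Qtau.
pose q := twist tau; have Qq a x : q a x \in Q by apply: conjQ.
have qE a x b y : q a x (E (b + x, y + Phi (b - a))) =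
    E (A b + B a x, B b y + Phi (A b - A a)).
  by rewrite /q /twist -s1E !permM permK !tauE s1E.
have q1 a x w : (E' (q a x w)).1 = A ((E' w).1 - x) + B a x.
  rewrite -[w]E'K; case: (E' w) => b y; rewrite EK /=.
  have -> : E (b, y) = E ((b - x) + x, (y - Phi (b - x - a)) + Phi (b - x - a)).
    by rewrite !subrK.
  by rewrite qE EK.
have tau1 w : (E' (tau w)).1 = A (E' w).1.
  by rewrite -[w]E'K; case: (E' w) => b y; rewrite tauE !EK.
have B_indep a x : B a x = B 0 x.
  apply/eqP; rewrite -subr_eq0; apply/eqP.
  apply: (@coprime_shift (fun w => (E' w).1) ((q 0 x)^-1 * q a x)%g) => [|w].
    by rewrite groupM ?groupV.
  rewrite permM -{2}[w](permKV (q 0 x)); move: (_ w) => {}w.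
  by rewrite !q1; ring.
have B0 : B 0 0 = 0.
  apply: (@coprime_shift (fun w => (E' w).1) (tau^-1 * q 0 0)%g) => [|w].
    by rewrite groupM ?groupV.
  rewrite permM -{2}[w](permKV tau); move: (_ w) => {}w.
  by rewrite q1 tau1 subr0.
exists A, (B 0); split=> // [b y|a x b y]; first by rewrite tauE B_indep.
by rewrite qE B_indep (B_indep b).
Qed.

(** The twist of [tau] splits as well. Reading it on two blocks where [Phi] differs gives [B] a
    constant increment along a nonzero step. *)
Lemma complement_affine tau : tau \in Q ->
  exists (A : F -> F) (alpha : F),
  [/\ forall b y, tau (E (b, y)) = E (A b, alpha * y)
    & forall a x b y, twist tau a x (E (b + x, y + Phi (b - a))) =
        E (A b + alpha * x, alpha * y + Phi (A b - A a))].
Proof.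
move=> Qtau; have [A [B [tauE B0 qE]]] := complement_split Qtau.
have [A' [B' [qE' _ _]]] := complement_split (conjQ (E (0, 0)) Qtau).
have [b1 nz_b1] : exists b, Phi b - Phi 0 != 0.
  apply/existsP; apply: contraT => /existsPn Phi_const; case: Phi_nc.
  by exists (Phi 0) => x; have := Phi_const x; rewrite negbK subr_eq0 => /eqP.
have B'E b y : B' (y + Phi b) = B y + Phi (A b - A 0).
  have := qE 0 0 b y; rewrite /twist qE' => /E_inj/(congr1 snd) /=.
  by rewrite subr0.
exists A, ((Phi (A b1 - A 0) - Phi 0) / (Phi b1 - Phi 0)).
have BE y : B y = (Phi (A b1 - A 0) - Phi 0) / (Phi b1 - Phi 0) * y.
  rewrite (affine_step (f := B) (L := Phi (A b1 - A 0) - Phi 0) nz_b1) ?B0 ?add0r // => z.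
  have := B'E b1 z; have := B'E 0 (z + (Phi b1 - Phi 0)).
  rewrite subrr addrA subrK => -> eqB; apply/eqP.
  by rewrite addrA eq_sym subr_eq eqB.
by split=> [b y|a x b y]; rewrite ?tauE ?qE !BE.
Qed.

Lemma complement_product tau : tau \in Q ->
  exists (A : F -> F) (alpha : F),
  [/\ forall b y, tau (E (b, y)) = E (A b, alpha * y), alpha != 0,
      forall a b, Phi (A b - A a) = alpha * Phi (b - a)
    & forall a x b y, twist tau a x (E (b + x, y)) = E (A b + alpha * x, alpha * y)].
Proof.
move=> Qtau; have [A [alpha [tauE qE]]] := complement_affine Qtau.
have alpha0 : alpha != 0.
  apply/eqP=> a0; have /perm_inj/E_inj/(congr1 snd)/eqP : tau (E (0, 0)) = tau (E (0, 1)).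
    by rewrite !tauE a0 !mul0r.
  by rewrite /= eq_sym oner_eq0.
have key (a x : F) : exists alpha' : F, forall b y,
    alpha' * (y + Phi (b - a)) = alpha * y + Phi (A b - A a).
  have [A' [alpha' [qE' _]]] := complement_affine (conjQ (E (a, x)) Qtau).
  exists alpha' => b y; have := qE a x b y; rewrite /twist qE'.
  by move/E_inj/(congr1 snd).
have Phi_alpha a b : Phi (A b - A a) = alpha * Phi (b - a).
  have [alpha' keya] := key a 0; have := keya b 0; have := keya b 1.
  rewrite mulr0 !add0r mulr1 => key1 key0; rewrite -key0; congr (_ * _).
  by apply: (addIr (Phi (A b - A a))); rewrite -key1 -key0; ring.
exists A, alpha; split=> // a x b y.
by rewrite -[y in LHS](subrK (Phi (b - a))) qE Phi_alpha; congr (E (_, _)); ring.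
Qed.

(** The elements of [Q] that keep heights form a group [K] normalised by the unit shift [z] of the
    first coordinate: on [K], conjugation by [z] is the twist at [(0, 1)]. As [z] is transitive on
    each row of p points, [K] is trivial. *)
Lemma complement_unipotent (pi : X -> F) g : (forall b y, pi (E (b, y)) = y) ->
  g \in Q -> (forall x, pi (g x) = pi x) -> g = 1%g.
Proof.
move=> piE; have [E' EK E'K] := E_bij.
pose K := [set k in Q | [forall x, pi (k x) == pi x]].
have KP k : reflect (k \in Q /\ forall x, pi (k x) = pi x) (k \in K).
  rewrite inE; apply: (iffP andP) => -[Qk piK]; split=> //.
    by move=> x; apply/eqP/(forallP piK).
  by apply/forallP=> x; rewrite piK.
have gK : group_set K.
  apply/group_setP; split=> [|k l /KP[Qk piK] /KP[Ql piL]]; apply/KP; split=> //.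
  - by move=> x; rewrite perm1.
  - exact: groupM.
  by move=> x; rewrite permM piL piK.
pose zf x := E ((E' x).1 + 1, (E' x).2).
have zf_inj : injective zf.
  move=> x x' /E_inj eqx; apply: (can_inj E'K).
  have /addIr eq1 := congr1 fst eqx; have /= eq2 := congr1 snd eqx.
  by rewrite [E' x]surjective_pairing [E' x']surjective_pairing eq1 eq2.
pose z := perm zf_inj.
have zE b y : z (E (b, y)) = E (b + 1, y) by rewrite permE /zf EK.
have K_id k : k \in K -> exists A, (forall b y, k (E (b, y)) = E (A b, y)) /\
    forall b y, twist k 0 1 (E (b + 1, y)) = E (A b + 1, y).
  move=> /KP[Qk piK]; have [A [alpha [kE _ _ qE]]] := complement_product Qk.
  have alpha1 : alpha = 1.
    by have := piK (E (0, 1)); rewrite kE !piE mulr1.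
  by exists A; split=> b y; rewrite ?kE ?qE alpha1 !mul1r.
have nKz : (<[z]> \subset 'N(Group gK))%g.
  rewrite cycle_subG inE; apply/subsetP=> _ /imsetP[k Kk ->].
  have [A [kE qE]] := K_id k Kk; have [Qk _] := KP _ Kk.
  have kzE : (k ^ z)%g = twist k 0 1.
    apply/permP=> x; rewrite -[x]E'K; case: (E' x) => b y.
    have -> : b = b - 1 + 1 by rewrite subrK.
    by rewrite (qE (b - 1)) -(zE (b - 1)) conjgE !permM permK kE zE.
  apply/KP; rewrite kzE; split=> [|x]; first exact: conjQ.
  rewrite -[x]E'K; case: (E' x) => b y.
  by rewrite -[b](subrK 1) qE !piE.
move=> Qg piG; have Kg : g \in Group gK by apply/KP.
have pK : (p^'.-group (Group gK))%g.
  by apply: pgroupS p'Q; apply/subsetP=> k /KP[].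
apply/permP=> x; rewrite perm1 -[x]E'K; case: (E' x) => b0 y.
pose S := [set E (b, y) | b : F].
have pS : p.-nat #|S|.
  by rewrite card_imset ?card_Fp ?pnat_id // => b b' /E_inj/(congr1 fst).
have actK : [acts Group gK, on S | 'P].
  apply/subsetP=> k Kk; rewrite !inE /=; apply/subsetP=> _ /imsetP[b _ ->].
  have [A [kE _]] := K_id k Kk.
  by rewrite inE /= /aperm kE imset_f.
have zX b n : (z ^+ n)%g (E (b, y)) = E (b + n%:R, y).
  elim: n => [|n IH]; first by rewrite perm1 addr0.
  by rewrite expgSr permM IH zE -addrA natr1.
have trz : [transitive <[z]>%g, on S | 'P].
  apply/imsetP; exists (E (0, y)); first exact: imset_f.
  apply/setP=> w; apply/imsetP/orbitP=> [[b _ ->]|[k /cycleP[n ->] <-]].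
    by exists (z ^+ b)%g; rewrite ?mem_cycle //= /aperm zX add0r natr_Zp.
  by exists (0 + n%:R); rewrite //= /aperm zX.
by apply: (normalized_orbits_fix pK pS actK nKz trz _ Kg); apply: imset_f.
Qed.

(** A twist of [tau] acts on heights like [tau], so it equals [tau] by [complement_unipotent]. By
    compatibility [s2] is then invariant under all [s1 u], hence constant by transitivity. *)
Lemma scaling_complement : exists alpha e : F,
  [/\ alpha != 0, forall t, Phi (alpha * t) = alpha * Phi t,
      forall v b y, s2 v (E (b, y)) = E (alpha * b + e, alpha * y)
    & alpha = 1 -> e = 0].
Proof.
have [E' EK E'K] := E_bij.
have Q2 v : s2 v \in Q by rewrite mem_gen ?imset_f.
have twist_id tau a x : tau \in Q -> twist tau a x = tau.
  move=> Qtau; have [A [alpha [tauE _ _ qE]]] := complement_product Qtau.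
  apply/eqP; rewrite eq_sym eq_mulVg1; apply/eqP.
  apply: (@complement_unipotent (fun x => (E' x).2)) => [b y||w]; first by rewrite EK.
    by rewrite groupM ?groupV // conjQ.
  rewrite permM -{2}[w](permKV tau); move: (_ w) => {}w.
  rewrite -[w]E'K; case: (E' w) => b y.
  by rewrite -[b](subrK x) qE tauE !EK.
have s2_const v : s2 v = s2 (E (0, 0)).
  apply/eqP; apply: (@transitive_stable _ _ (fun v => s2 v == s2 (E (0, 0)))
    (E (0, 0)) trP) => // u {}v /eqP <-.
  rewrite -[u]E'K; case: (E' u) => a x.
  by rewrite -(twist_id (s2 v) a x (Q2 v)) /twist -mulgA -compat mulKg.
have [A [alpha [tauE alpha0 Phi_alpha qE]]] := complement_product (Q2 (E (0, 0))).
have AE b : A b = alpha * b + A 0.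
  have := qE 0 b 0 0; rewrite twist_id // add0r tauE => /E_inj/(congr1 fst) /= ->.
  by rewrite addrC.
exists alpha, (A 0); split=> // [t|v b y|alpha1].
- by rewrite -[t in RHS]subr0 -Phi_alpha AE addrK.
- by rewrite s2_const tauE AE.
apply: (@coprime_shift (fun x => (E' x).1) _ _ (Q2 (E (0, 0)))) => x.
rewrite -[x]E'K; case: (E' x) => b y.
by rewrite tauE !EK AE alpha1 mul1r.
Qed.
End ScalingComplement.

(** * From solutions to cycle sets *)

Section CycleForm.

(** With [s x] inverse to [lambda r x], this formula determines [r] and has involutivity built
    in. *)
Definition cycle_form (X : Type) (r : X * X -> X * X) (s : X -> X -> X) :=
  (forall x, bijective (s x)) /\ forall x y, r (x, s x y) = (y, s y x).

Lemma cycle_form_hom (X Y : Type) r s r' s' (f : X -> Y) :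
    cycle_form r s -> cycle_form r' s' ->
  (forall x y, f (s x y) = s' (f x) (f y)) <-> yb_hom r r' f.
Proof.
move=> [s_bij rE] [s'_bij r'E]; split=> [fs ff [x y0]|fr x y].
  have [t _ sK] := s_bij x; rewrite /ff /= -(sK y0) rE /= !fs r'E.
  by [].
have [t _ tK] := s'_bij (f x).
have : f y = t (f (s x y)); last by move->; rewrite tK.
by have := congr1 fst (fr (x, s x y)); rewrite /= rE /= -{1}[f (s x y)]tK r'E.
Qed.

Lemma solution_cycle_form (X : finType) (r : X * X -> X * X) :
    yb_solution r -> Defs.nondegenerate r -> involutive r ->
  exists sg : X -> {perm X},
  [/\ cycle_set sg, injective (fun u => sg u u) & cycle_form r sg].
Proof.
move=> [_ yb] [l_bij rho_bij] rK.
pose l x := perm (bij_inj (l_bij x)).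
have lE x y : l x y = (r (x, y)).1 by rewrite permE.
pose sg x := (l x)^-1%g.
have rE x y : r (x, sg x y) = (y, sg y x).
  have r1 : (r (x, sg x y)).1 = y by rewrite -lE permKV.
  case def_r: (r _) r1 => [a b] /= eq_a; rewrite {a}eq_a in def_r *; congr pair.
  apply: (@perm_inj _ (l y)); rewrite permKV lE.
  by have := rK (x, sg x y); rewrite def_r /= => ->.
have sgC : cycle_set sg.
  move=> x y; apply: invg_inj; rewrite !invMg !invgK.
  apply/permP=> w; rewrite !permM !lE.
  have := yb (x, sg x y, w).
  rewrite /= /times_id /id_times /= rE /=.
  case: (r (sg y x, w)) => a b /=; case: (r (sg x y, w)) => c d /=.
  case: (r (x, c)) => e f /=; case: (r (f, d)) => g h.
  by move/(congr1 (fun t => t.1.1)) => /= ->.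
exists sg; split=> //; last by split=> // x; apply: injF_bij; apply: perm_inj.
(* The pair [(u, sg u u)] is fixed by [r], so [rho] at the common square maps both [u] and [v] to
   that square. *)
move=> u v eqw; apply: (bij_inj (rho_bij (sg u u))).
by rewrite /rho rE [in RHS]eqw rE -eqw.
Qed.

Lemma indecomposable_transitive (X : finType) (r : X * X -> X * X) (sg : X -> {perm X}) :
  cycle_form r sg -> injective r -> indecomposable r -> (0 < #|X|)%N ->
  [transitive gens sg, on setT | 'P].
Proof.
move=> [_ rE] r_inj indec /card_gt0P[x0 _].
pose A := orbit 'P (gens sg) x0.
have stA x y : (sg x y \in A) = (y \in A).
  rewrite -[sg x y]/('P%act y (sg x)); apply: (acts_act (acts_orbit _ _ (subsetT _))).
  by rewrite mem_gen ?imset_f.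
have imr (B : {set X}) :
    (forall x y, (sg x y \in B) = (y \in B)) -> r @: setX B B = setX B B.
  move=> stB; apply/eqP; rewrite eqEcard card_imset // leqnn andbT.
  apply/subsetP=> _ /imsetP[[x y] /setXP[Bx By] ->].
  have [z def_y] : exists z, y = sg x z by exists ((sg x)^-1%g y); rewrite permKV.
  by rewrite def_y stB in By *; rewrite rE in_setX By stB.
apply/imsetP; exists x0 => //; apply/eqP; rewrite eq_sym -subTset -setCS setCT subset0.
apply: contraT => A'0; case: indec; exists A, (~: A); split; split=> //.
- exact: setUCr.
- by rewrite disjoints_subset setCK.
- by apply/set0Pn; exists x0; apply: orbit_refl.
- exact: imr.
by apply: imr => x y; rewrite !inE stA.
Qed.
End CycleForm.

(** * The cycle sets of the three models *)

Section Models.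
Variable p : nat.
Notation F := 'F_p.

Definition translation_cycle (S : F) (Phi : F -> F) (u v : F * F) : F * F :=
  (v.1 + 1, v.2 + chi0 v.1 * S + Phi (v.1 - u.1)).

Definition scaling_cycle (alpha : F) (Phi : F -> F) (u v : F * F) : F * F :=
  (alpha * (v.1 + u.2), alpha * (v.2 + Phi (v.1 - u.1))).

Lemma cyclic_cycle_form : cycle_form (@cyclic_map p) (fun _ y => y - 1).
Proof.
split=> [_|x y]; first by exists (+%R^~ 1) => y; rewrite ?subrK ?addrK.
by rewrite /= subrK.
Qed.

Lemma translation_cycle_form S Phi :
  cycle_form (translation_map S Phi) (translation_cycle S Phi).
Proof.
split=> [[a x]|[a x] [b y]].
  apply: injF_bij => -[b y] [b' y'] eq_v.
  have /= /addIr eq_b := congr1 fst eq_v; have /= := congr1 snd eq_v.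
  by rewrite eq_b => /addIr/addIr ->.
rewrite /translation_map /translation_cycle /= !addrK.
by congr ((_, _), (_, _)); [ring | congr (_ + Phi _); ring].
Qed.

Lemma scaling_cycle_form alpha Phi : scaling_param alpha Phi ->
  cycle_form (scaling_map alpha Phi) (scaling_cycle alpha Phi).
Proof.
move=> [_ _ alpha0 Phi_alpha]; split=> [[a x]|[a x] [b y]].
  apply: injF_bij => -[b y] [b' y'] eq_v.
  have /= /(mulfI alpha0)/addIr eq_b := congr1 fst eq_v; have /= := congr1 snd eq_v.
  by rewrite eq_b => /(mulfI alpha0)/addIr ->.
have -> : scaling_map alpha Phi ((a, x), scaling_cycle alpha Phi (a, x) (b, y)) =
  scaling_map alpha Phi ((a, x), (alpha * (b + x), alpha * (y + Phi (b - a)))) by [].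
rewrite /scaling_map /scaling_cycle /= !mulKf // addrK addrK.
have -> : alpha * (b + x) - alpha * x - alpha * a = alpha * (b - a) by ring.
have -> : alpha * a + alpha * x - alpha * (b + x) = alpha * (a - b) by ring.
by rewrite !Phi_alpha; congr ((_, _), (_, _)); ring.
Qed.
End Models.

(** * Matching coordinates with the models *)

Section Classification.
Variables (p : nat) (X : finType) (r : X * X -> X * X) (sg : X -> {perm X}).
Hypothesis p_pr : prime p.
Notation F := 'F_p.
Hypothesis cardX : #|X| = (p ^ 2)%N.
Hypothesis r_sg : cycle_form r sg.

Lemma isomorphic_coordinates (Y : Type) (t : Y * Y -> Y * Y) (s : Y -> Y -> Y)
    (E : Y -> X) :
    cycle_form t s -> bijective E -> (forall u v, sg (E u) (E v) = E (s u v)) ->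
  yb_isomorphic r t.
Proof.
move=> t_s [E' EK E'K] sE; exists E'; first by exists E.
apply/(cycle_form_hom E' r_sg t_s) => x y.
by rewrite -{1}[x]E'K -{1}[y]E'K sE EK.
Qed.

Lemma constant_cyclic (h : {perm X}) : [transitive gens sg, on setT | 'P] ->
  (forall u, sg u = h) -> yb_isomorphic r (@cyclic_map p).
Proof.
move=> trG sgh; have [x0 _ defX] := imsetP trG.
have p2_gt1 : (1 < p ^ 2)%N by rewrite -(exp1n 2) ltn_exp2r ?prime_gt1.
have defG : gens sg = <[h]>%g.
  congr <<_>>%g; apply/setP=> g; rewrite [RHS]inE.
  by apply/imsetP/eqP=> [[u _ ->]|->]; [apply: sgh | exists x0; rewrite ?sgh].
have porb x : x \in porbit h^-1%g x0.
  rewrite porbitV; have : x \in orbit 'P (gens sg) x0 by rewrite -defX.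
  by rewrite defG => /orbitP[_ /cycleP[i ->] <-]; apply/porbitP; exists i.
have card_porb : #|porbit h^-1%g x0| = (p ^ 2)%N.
  by rewrite -cardX; apply: eq_card => x; rewrite porb.
(* Inverse powers, since [h] has to act as [y - 1] in the cyclic model. *)
pose E (i : 'Z_(p ^ 2)) := (h^-1 ^+ i)%g x0.
have EX n : (h^-1 ^+ n)%g x0 = E n%:R.
  have fix_x0 : (h^-1 ^+ (p ^ 2))%g x0 = x0 by rewrite permX -card_porb iter_porbit.
  have {fix_x0}fix_x0 k : (h^-1 ^+ (p ^ 2 * k))%g x0 = x0.
    by rewrite expgM; elim: k => [|k IH]; rewrite ?perm1 // expgS permM fix_x0.
  by rewrite /E val_Zp_nat // {1}(divn_eq n (p ^ 2)) expgD permM mulnC fix_x0.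
have ex_E x : exists i, E i == x.
  by have /porbitP[i ->] := porb x; exists i%:R; rewrite EX.
have EK : cancel (fun x => xchoose (ex_E x)) E by move=> x; apply/eqP/(xchooseP (ex_E x)).
have E_bij : bijective E.
  apply: (bij_can_bij _ EK); apply: inj_card_bij; first exact: can_inj EK.
  by rewrite card_ord Zp_cast // cardX.
apply: (isomorphic_coordinates (@cyclic_cycle_form p) E_bij) => u v; rewrite sgh.
have ES w : (h^-1)%g (E w) = E (w + 1).
  by rewrite -[w in RHS]natr_Zp natr1 -EX expgSr permM.
by rewrite -{1}[v](subrK 1) -ES permKV.
Qed.

(** Changing heights by [g] turns the diagonal of [Psi] into [chi0 b * S]. If the remaining [Phi] is
    zero, [sg] no longer depends on its index and the solution is cyclic. *)
Lemma translation_normal_form (E : F * F -> X) Psi : cycle_set sg ->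
    [transitive gens sg, on setT | 'P] -> translation_coordinates sg E Psi ->
  yb_isomorphic r (@cyclic_map p) \/
  exists (S : F) (Phi : F -> F),
    translation_param Phi /\ yb_isomorphic r (translation_map S Phi).
Proof.
move=> sgC trG [E_bij sgE].
have Psi_diag a b : Psi a b = Psi b b + (Psi (a - b) 0 - Psi 0 0).
  have Ec : block_coordinates sg E (fun=> 1) (fun u b => Psi u.1 b).
    by split=> // -[a' x] b' y; rewrite sgE.
  exact: (unit_shift_diagonal (block_cycle sgC Ec)).
pose Phi t := Psi (- t) 0 - Psi 0 0.
have [g [S gS]] := coboundary_correction (fun b => Psi b b) p_pr.
pose E2 (u : F * F) := E (u.1, u.2 - g u.1).
have E2_bij : bijective E2.
  by apply: (bijective_change (g := fun u => (u.1, u.2 + g u.1)) E_bij) => -[b y] /=;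
    rewrite subrK.
have sgE2 u v : sg (E2 u) (E2 v) = E2 (translation_cycle S Phi u v).
  case: u v => [a x] [b y]; rewrite /E2 sgE /= Psi_diag /Phi opprB -gS.
  by congr (E (_, _)); ring.
have Phi0 : Phi 0 = 0 by rewrite /Phi oppr0 subrr.
have [/forallP Phi_const|/forallPn[t nz]] := boolP [forall t, Phi t == 0]; [left|right].
  apply: (@constant_cyclic (sg (E (0, 0))) trG) => u; have [E' _ E'K] := E2_bij.
  apply/permP=> w; rewrite -[u]E'K -[w]E'K.
  have -> : E (0, 0) = E2 (0, g 0) by rewrite /E2 subrr.
  by rewrite !sgE2 /translation_cycle !(eqP (Phi_const _)).
exists S, Phi; split.
  split=> // -[k Phi_k]; case/eqP: nz.
  by rewrite Phi_k -(Phi_k 0) Phi0.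
exact: isomorphic_coordinates (translation_cycle_form S Phi) E2_bij sgE2.
Qed.

End Classification.

Theorem classification (p : nat) (X : finType) (r : X * X -> X * X) : prime p ->
    indecomposable_solution r -> #|X| = (p ^ 2)%N ->
  [\/ yb_isomorphic r (@cyclic_map p),
      exists (S : 'F_p) (Phi : 'F_p -> 'F_p),
        translation_param Phi /\ yb_isomorphic r (translation_map S Phi)
    | exists (alpha : 'F_p) (Phi : 'F_p -> 'F_p),
        scaling_param alpha Phi /\ yb_isomorphic r (scaling_map alpha Phi)].
Proof.
move=> p_pr [yb nd rK indec] cardX.
have [sg [sgC sg_sq r_sg]] := solution_cycle_form yb nd rK.
have r_inj : injective r := can_inj rK.
have p2_gt1 : (1 < #|X|)%N by rewrite cardX -(exp1n 2) ltn_exp2r ?prime_gt1.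
have trG := indecomposable_transitive r_sg r_inj indec (ltnW p2_gt1).
have pX : p.-nat #|X| by rewrite cardX pnatX pnat_id.
have [s1 [s2 [[s1C pP trP autz] [p'Q fact compat conjQ]]]] :=
  pgroup_pieces sgC sg_sq p_pr pX p2_gt1 trG.
have [[E [Psi [E_bij s1E]]]|[E [Phi [E_bij Phi_nc Phi_even s1E]]]] :=
  prime_square_coordinates p_pr s1C pP trP cardX autz.
  have [E' EK E'K] := E_bij.
  have s2_1 v : s2 v = 1%g.
    apply: (complement_trivial p_pr cardX s1C pP trP p'Q conjQ) => {v} u u' v.
    apply/permP=> w; rewrite -[u]E'K -[u']E'K -[v]E'K -[w]E'K.
    case: (E' u) (E' u') (E' v) (E' w) => [a x] [a' x'] [b y] [d z].
    by rewrite !s1E.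
  have sgE : translation_coordinates sg E Psi.
    by split=> // a x b y; rewrite fact s2_1 mulg1 s1E.
  by case: (translation_normal_form p_pr cardX r_sg sgC trG sgE) => [?|?];
    [apply: Or31 | apply: Or32].
have [alpha [e [alpha0 Phi_alpha s2E e0]]] :=
  scaling_complement p_pr trP p'Q conjQ compat E_bij Phi_nc Phi_even s1E.
apply: Or33; exists alpha, Phi.
have param : scaling_param alpha Phi by split.
split=> //.
(* A fixed point exists because [e = 0] when [alpha = 1]; taking it as origin removes [e]. *)
have [e' e'E] : exists e', alpha * e' + e = e'.
  have [al1|al1] := eqVneq alpha 1; first by exists 0; rewrite mulr0 e0 // addr0.
  exists (e / (1 - alpha)); field; by rewrite subr_eq0 eq_sym.
apply: (isomorphic_coordinates r_sg (scaling_cycle_form param)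
  (E := fun u => E (u.1 + e', u.2))).
  by apply: (bijective_change (g := fun u => (u.1 - e', u.2)) E_bij) => -[b y] /=;
    rewrite addrK.
move=> [a x] [b y]; rewrite fact permM /= !s1E s2E /scaling_cycle /=.
have -> : alpha * (b + x) + e' = alpha * (b + e' + x) + e by rewrite -{1}e'E; ring.
by congr (E (_, _ * (_ + Phi _))); ring.
Qed.

(** * The models are indecomposable solutions *)

Section FromCycleForm.
Variables (X : finType) (r : X * X -> X * X) (s : X -> X -> X).
Hypothesis r_s : cycle_form r s.
Hypothesis s_cycle : forall x y z, s (s x y) (s x z) = s (s y x) (s y z).

Lemma cycle_form_involutive : involutive r.
Proof.
have [s_bij rE] := r_s; case=> x y; have [t _ tK] := s_bij x.
by rewrite -(tK y) !rE.
Qed.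

Lemma cycle_form_solution : yb_solution r.
Proof.
have [s_bij rE] := r_s; split; first by exists r; exact: cycle_form_involutive.
(* Every triple has the form [(x, s x y, s (s x y) (s x z))], on which each application of [r] is
   explicit. *)
case=> -[x y0] z0; have [t _ tK] := s_bij x; rewrite -(tK y0); move: (t y0) => y.
have [t' _ t'K] := s_bij (s x y); rewrite -(t'K z0) -(tK (t' z0)).
move: (t _) => z.
rewrite /= /times_id /id_times /= rE /= [in LHS]s_cycle [in LHS]rE /= rE.
by rewrite rE /= rE (s_cycle x z y) rE (s_cycle y z x).
Qed.

Lemma cycle_form_stable (C : {set X}) x y : r @: setX C C = setX C C -> x \in C ->
  (s x y \in C) = (y \in C).
Proof.
have [s_bij rE] := r_s => rC Cx.
have sub : s x @^-1: C \subset C.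
  apply/subsetP=> w; rewrite inE => Cw.
  have : r (x, s x w) \in setX C C by rewrite -rC imset_f // in_setX Cx.
  by rewrite rE in_setX => /andP[].
suff -> : (s x y \in C) = (y \in s x @^-1: C).
  have /eqP -> // : s x @^-1: C == C.
  by rewrite eqEcard sub (card_preimset _ (bij_inj (s_bij x))) /=.
by rewrite inE.
Qed.

Lemma cycle_form_indecomposable :
    (forall m : X -> bool, (forall x y, m (s x y) = m y) -> forall x y, m x = m y) ->
  indecomposable r.
Proof.
move=> s_irr [A [B [[AB dAB /set0Pn[x Ax] /set0Pn[y By]] [rA rB]]]].
have BE z : (z \in B) = (z \notin A).
  have := in_setT z; rewrite -AB inE.
  by have := disjointFr dAB (x := z); case: (z \in A) => [->|].
have sA u v : (s u v \in A) = (v \in A).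
  have [Au|nAu] := boolP (u \in A); first exact: cycle_form_stable.
  by apply: negb_inj; rewrite -!BE; apply: cycle_form_stable; rewrite ?BE.
by move: By; rewrite BE -(s_irr (fun z => z \in A) sA x) Ax.
Qed.

Lemma cycle_form_indecomposable_solution :
    (forall y, injective (rho r y)) ->
    (forall m : X -> bool, (forall x y, m (s x y) = m y) -> forall x y, m x = m y) ->
  indecomposable_solution r.
Proof.
move=> rho_inj s_irr; have [s_bij rE] := r_s; split.
- exact: cycle_form_solution.
- split=> [x|y]; last exact: injF_bij.
  apply: injF_bij => y z; have [t _ tK] := s_bij x.
  by rewrite /lambda -(tK y) -(tK z) !rE /= => ->.
- exact: cycle_form_involutive.
exact: cycle_form_indecomposable.
Qed.
End FromCycleForm.

Section ModelSolutions.
Variable p : nat.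
Hypothesis p_pr : prime p.
Notation F := 'F_p.

Lemma nonconstant_diff (Phi : F -> F) : nonconstant Phi -> exists s t, Phi s - Phi t != 0.
Proof.
move=> Phi_nc; have [/forallP Phi_c|/forallPn[s nz]] := boolP [forall s, Phi s == Phi 0].
  by case: Phi_nc; exists (Phi 0) => s; apply/eqP.
by exists s, 0; rewrite subr_eq0.
Qed.

Lemma cyclic_map_solution : indecomposable_solution (@cyclic_map p).
Proof.
apply: (cycle_form_indecomposable_solution (@cyclic_cycle_form p)) => //.
  by move=> y x x' /= /addIr.
move=> m mS.
have m0 x : m x = m 0.
  rewrite -[x]natr_Zp; elim: (x : nat) => [|n IH] //.
  by rewrite -natr1 -[LHS](mS 0) addrK.
by move=> x y; rewrite !m0 -(m0 y).
Qed.

Lemma translation_map_solution S Phi : translation_param Phi ->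
  indecomposable_solution (translation_map S Phi : _ -> (F * F) * (F * F)).
Proof.
move=> [Phi_nc _].
apply: (cycle_form_indecomposable_solution (translation_cycle_form S Phi)).
- move=> [a x] [b y] [d z]; rewrite /translation_cycle /=; congr (_, _).
  have -> : d + 1 - (b + 1) = d - b by ring.
  have -> : d + 1 - (a + 1) = d - a by ring.
  by ring.
- move=> [b y] [a x] [a' x'] eqr; have /= /addIr eq_a := congr1 fst eqr.
  by have /= := congr1 snd eqr; rewrite eq_a => /addIr/addIr ->.
move=> m ms; have [t1 [t2 nz]] := nonconstant_diff Phi_nc.
have m1 b y : m (b, y) = m (b, 0).
  apply: (periodic_const (f := fun y => m (b, y)) nz) => {}y.
  (* The two points have a common image when moved with indices in the blocks [b - t2] and [b - t1]
     respectively. *)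
  rewrite -(ms (b - t2, 0)) -(ms (b - t1, 0) (b, y)) /translation_cycle /=.
  by congr (m (_, _)); rewrite !subKr; ring.
have m0 u : m u = m (0, 0).
  case: u => b y; rewrite m1.
  apply: (periodic_const (f := fun b => m (b, 0)) (oner_neq0 _)) => {}b.
  by rewrite -(ms (0, 0) (b, 0)) /translation_cycle /= [RHS]m1.
by move=> u v; rewrite !m0 -(m0 v).
Qed.

Lemma scaling_map_solution alpha Phi : scaling_param alpha Phi ->
  indecomposable_solution (scaling_map alpha Phi : _ -> (F * F) * (F * F)).
Proof.
move=> param; have [Phi_nc Phi_even alpha0 Phi_alpha] := param.
apply: (cycle_form_indecomposable_solution (scaling_cycle_form param)).
- move=> [a x] [b y] [d z]; rewrite /scaling_cycle /=.
  rewrite -!mulrBr !Phi_alpha (Phi_even (a - b)) opprB.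
  have -> : d + x - (b + x) = d - b by ring.
  have -> : d + y - (a + y) = d - a by ring.
  by congr (_, _); ring.
- move=> [b y] [a x] [a' x'] eqr; have := congr1 fst eqr; have := congr1 snd eqr.
  rewrite /rho /=.
  have -> : b - alpha * x - alpha * a = - (alpha * a + alpha * x - b) by ring.
  have -> : b - alpha * x' - alpha * a' = - (alpha * a' + alpha * x' - b) by ring.
  rewrite -!Phi_even; set k := Phi _; set k' := Phi _ => eq2 eq1.
  (* In the sum of both components the values of [Phi] cancel; this recovers the argument of
     [Phi]. *)
  have eq_sum : alpha * a + alpha * x = alpha * a' + alpha * x'.
    apply: (addIr y); transitivity (alpha * a + y - k + (alpha * x + k)); first by ring.
    by rewrite eq1 eq2; ring.
  move: eq1 eq2; rewrite /k /k' eq_sum => /addIr/addIr/(mulfI alpha0) ->.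
  by move=> /addIr/(mulfI alpha0) ->.
move=> m ms; have [t1 [t2 nz]] := nonconstant_diff Phi_nc.
have m1 b y : m (b, y) = m (b, 0).
  apply: (periodic_const (f := fun y => m (b, y)) nz) => {}y.
  rewrite -(ms (b - t2, 0)) -(ms (b - t1, 0) (b, y)) /scaling_cycle /=.
  by congr (m (_, _)); rewrite !subKr; ring.
have m0 u : m u = m (0, 0).
  case: u => b y; rewrite m1 -(ms (b, 0) (b, 0)) -(ms (0, b) (0, 0)) /scaling_cycle /=.
  by congr (m (_, _)); rewrite ?subrr; ring.
by move=> u v; rewrite !m0 -(m0 v).
Qed.

End ModelSolutions.

(** * Isomorphism classes *)

Lemma isomorphic_cycle_form (X Y : Type) r s r' s' :
    @cycle_form X r s -> @cycle_form Y r' s' ->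
  yb_isomorphic r r' <->
  exists2 f : X -> Y, bijective f & forall x y, f (s x y) = s' (f x) (f y).
Proof.
by move=> r_s r_s'; split=> -[f f_bij fE]; exists f => //;
  apply/(cycle_form_hom f r_s r_s').
Qed.

Section Isomorphisms.
Variable p : nat.
Hypothesis p_pr : prime p.
Notation F := 'F_p.

(** Images of one point under different indices differ by values of [Phi] in height. This forces an
    isomorphism to preserve blocks, shift them by some [t] and be affine of slope [alpha] on
    heights. *)
Lemma translation_isomorphic (S S' : F) (Phi Phi' : F -> F) :
    translation_param Phi -> translation_param Phi' ->
  yb_isomorphic (translation_map S Phi) (translation_map S' Phi') <->
  exists alpha : F,
    [/\ alpha != 0, alpha * S = S' & forall x, alpha * Phi x = Phi' x].
Proof.
move=> [Phi_nc Phi0] [_ Phi'0].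
apply: (iff_trans (isomorphic_cycle_form (translation_cycle_form S Phi)
  (translation_cycle_form S' Phi'))).
split=> [[f f_bij fE]|[alpha [alpha0 SE PhiE]]]; last first.
  exists (fun u => (u.1, alpha * u.2)).
    by exists (fun u => (u.1, u.2 / alpha)) => -[b y] /=; congr (_, _); field.
  move=> [a x] [b y]; rewrite /translation_cycle /= -SE -PhiE.
  by congr (_, _); ring.
pose A b y := (f (b, y)).1; pose B b y := (f (b, y)).2.
have [t1 [t2 nz]] := nonconstant_diff Phi_nc.
have A_S a b y : A (b + 1) (y + chi0 b * S + Phi (b - a)) = A b y + 1.
  exact: (congr1 fst (fE (a, 0) (b, y))).
have A_indep b y : A b y = A b 0.
  apply: (periodic_const (f := A b) nz) => {}y.
  pose w := y - chi0 (b - 1) * S - Phi t2.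
  have wE t : A b (w + chi0 (b - 1) * S + Phi t) = A (b - 1) w + 1.
    by rewrite -(A_S (b - 1 - t)) subKr subrK.
  have -> : y + (Phi t1 - Phi t2) = w + chi0 (b - 1) * S + Phi t1 by rewrite /w; ring.
  by rewrite wE -(wE t2); congr (A _ _); rewrite /w; ring.
pose t := A 0 0.
have AE b y : A b y = b + t.
  rewrite A_indep (affine_step (f := fun b => A b 0) (k := 1) (L := 1)) ?oner_neq0 //.
    by rewrite divr1 mul1r addrC.
  by move=> {}b; rewrite -(A_S 0 b 0) [RHS]A_indep.
have B_S a b y : B (b + 1) (y + chi0 b * S + Phi (b - a)) =
    B b y + chi0 (b + t) * S' + Phi' (b - a).
  have := congr1 snd (fE (a, 0) (b, y)); rewrite /translation_cycle /= -!/(A _ _) !AE.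
  by have -> : b + t - (a + t) = b - a by ring.
pose alpha := (Phi' t1 - Phi' t2) / (Phi t1 - Phi t2).
have BE b y : B b y = B b 0 + alpha * y.
  apply: (affine_step (f := B b) nz) => {}y.
  pose w := y - chi0 (b - 1) * S - Phi t2.
  have wE t0 : B b (w + chi0 (b - 1) * S + Phi t0) =
      B (b - 1) w + chi0 (b - 1 + t) * S' + Phi' t0.
    by have := B_S (b - 1 - t0) (b - 1) w; rewrite subKr subrK.
  have -> : y + (Phi t1 - Phi t2) = w + chi0 (b - 1) * S + Phi t1 by rewrite /w; ring.
  have -> : y = w + chi0 (b - 1) * S + Phi t2 by rewrite /w; ring.
  by rewrite !wE; ring.
have key a b : B (b + 1) 0 - B b 0 + alpha * (chi0 b * S) - chi0 (b + t) * S' =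
    Phi' (b - a) - alpha * Phi (b - a).
  have := B_S a b 0; rewrite (BE (b + 1)) => /(canRL (addrK _)) ->.
  by ring.
have key0 b : B (b + 1) 0 - B b 0 + alpha * (chi0 b * S) - chi0 (b + t) * S' = 0.
  by rewrite (key b b) subrr Phi0 Phi'0 mulr0 subrr.
exists alpha; split.
- apply/eqP=> alpha_0; have /(congr1 snd)/eqP : (0 : F, 0 : F) = (0, 1).
    apply: (bij_inj f_bij).
    rewrite [f (0, 0)]surjective_pairing [f (0, 1)]surjective_pairing.
    by rewrite -!/(A _ _) -!/(B _ _) !AE (BE 0 1) alpha_0 mul0r addr0.
  by rewrite /= eq_sym oner_eq0.
(* Summing [key0] over ['F_p] kills both the coboundary in [B] and the shift [t] of [chi0]. *)
- have sum_chi c : \sum_(b : F) chi0 (b + c) = 1 :> F.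
    rewrite (bigD1 (- c)) //= addNr /chi0 eqxx big1 ?addr0 // => b.
    by rewrite -addr_eq0 => /negPf->.
  have sumB : \sum_(b : F) B (b + 1) 0 = \sum_(b : F) B b 0.
    by rewrite [RHS](reindex_inj (addIr 1)).
  have : \sum_(b : F) (B (b + 1) 0 - B b 0 + alpha * (chi0 b * S) - chi0 (b + t) * S') = 0.
    by rewrite big1.
  rewrite !big_split /= !sumrN sumB subrr add0r -mulr_sumr -!mulr_suml sum_chi.
  under eq_bigr do rewrite -[X in chi0 X]addr0.
  by rewrite sum_chi !mul1r => /eqP; rewrite subr_eq0 => /eqP.
move=> x; have := key (0 - x) 0; rewrite key0 subKr => /esym/eqP.
by rewrite subr_eq0 eq_sym => /eqP.
Qed.

(** For odd p, evaluation midway between the blocks 0 and [a] shows by evenness that [B] does not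
    depend on the block; then [f] is multiplication by one scalar up to a shift of blocks, and the
    scalar of the statement is its inverse. *)
Lemma scaling_isomorphic (alpha alpha' : F) (Phi Phi' : F -> F) :
    scaling_param alpha Phi -> scaling_param alpha' Phi' ->
  yb_isomorphic (scaling_map alpha Phi) (scaling_map alpha' Phi') <->
  alpha = alpha' /\
  exists beta : F, beta != 0 /\ forall x, beta^-1 * Phi (beta * x) = Phi' x.
Proof.
move=> par par'; have [Phi_nc Phi_even alpha0 Phi_alpha] := par.
have [Phi'_nc Phi'_even alpha'0 Phi'_alpha] := par'.
apply: (iff_trans (isomorphic_cycle_form (scaling_cycle_form par)
  (scaling_cycle_form par'))).
split=> [[f f_bij fE]|[eq_alpha [beta [beta0 PhiE]]]]; last first.
  exists (fun u => (beta^-1 * u.1, beta^-1 * u.2)).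
    by exists (fun u => (beta * u.1, beta * u.2)) => -[b y] /=; congr (_, _); field.
  move=> [a x] [b y]; rewrite /scaling_cycle /= -eq_alpha -PhiE.
  have -> : beta * (beta^-1 * b - beta^-1 * a) = b - a by field.
  by congr (_, _); ring.
(* For p = 2 a nonconstant [Phi] is determined by [Phi 0], and [Phi 0 = 0] is detected by a fixed
   point of the squaring map of the cycle set. *)
have [p2|p_odd] := eqVneq p 2%N.
  have F2 x := @Fp2_cases p p_pr x p2.
  have alpha1 : alpha = 1 by case: (F2 alpha) alpha0 => -> //; rewrite eqxx.
  have alpha'1 : alpha' = 1 by case: (F2 alpha') alpha'0 => -> //; rewrite eqxx.
  split; first by rewrite alpha1.
  exists 1; split=> [|x]; first exact: oner_neq0.
  rewrite invr1 !mul1r.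
  have fixP (Psi : F -> F) u : scaling_cycle 1 Psi u u = u <-> u.2 = 0 /\ Psi 0 = 0.
    case: u => a x0; rewrite /scaling_cycle /= subrr !mul1r; split=> [eq_u|[-> ->]].
      have /= eq1 := congr1 fst eq_u; have /= eq2 := congr1 snd eq_u.
      by split; [apply: (addrI a) | apply: (addrI x0)]; rewrite addr0.
    by rewrite !addr0.
  have Phi00 : Phi 0 = 0 <-> Phi' 0 = 0.
    have fix_f u : scaling_cycle 1 Phi u u = u <-> scaling_cycle 1 Phi' (f u) (f u) = f u.
      rewrite -{1}alpha1 -{1}alpha'1 -fE; split=> [->//|]; exact: (bij_inj f_bij).
    have [f' _ f'K] := f_bij; split=> Phi_0.
      by have /fix_f/fixP[] : scaling_cycle 1 Phi (0, 0) (0, 0) = (0, 0) by apply/fixP.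
    have : scaling_cycle 1 Phi' (0, 0) (0, 0) = (0, 0) by apply/fixP.
    by rewrite -(f'K (0, 0)) => /fix_f/fixP[].
  have other (Psi : F -> F) : nonconstant Psi -> Psi 1 = Psi 0 + 1.
    move=> Psi_nc; case: (F2 (Psi 1 - Psi 0)) => [/eqP|eq1]; last first.
      by rewrite -[LHS](subrK (Psi 0)) eq1 addrC.
    rewrite subr_eq0 => /eqP eqPsi; case: Psi_nc; exists (Psi 0) => z.
    by case: (F2 z) => ->.
  have eq0 : Phi 0 = Phi' 0.
    case: (F2 (Phi 0)) => [Phi_0|Phi_1]; first by rewrite Phi_0; apply/esym/Phi00.
    case: (F2 (Phi' 0)) => [/Phi00|->//].
    by rewrite Phi_1 => /eqP; rewrite oner_eq0.
  by case: (F2 x) => ->; rewrite ?(other _ Phi_nc) ?(other _ Phi'_nc) eq0.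
pose A b y := (f (b, y)).1; pose B b y := (f (b, y)).2.
have two_nz := Fp_two_neq0 p_pr p_odd.
have f1 a x b y : A (alpha * (b + x)) (alpha * (y + Phi (b - a))) = alpha' * (A b y + B a x).
  exact: (congr1 fst (fE (a, x) (b, y))).
have f2 a x b y : B (alpha * (b + x)) (alpha * (y + Phi (b - a))) =
    alpha' * (B b y + Phi' (A b y - A a x)).
  exact: (congr1 snd (fE (a, x) (b, y))).
have B_indep a x : B a x = B 0 x.
  have := f1 a x (a / 2) 0; have := f1 0 x (a / 2) 0.
  have -> : a / 2 - a = - (a / 2) by field.
  by rewrite subr0 -Phi_even => -> /(mulfI alpha'0)/addrI.
have [t1 [t2 nz]] := nonconstant_diff Phi_nc.
have A_indep b y : A b y = A b 0.
  apply: (periodic_const (f := A b) (k := alpha * (Phi t1 - Phi t2))) => [|{}y].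
    by rewrite mulf_neq0.
  pose w := y / alpha - Phi t2.
  have wE t : A b (alpha * (w + Phi t)) = alpha' * (A (b / alpha) w + B 0 0).
    have := f1 (b / alpha - t) 0 (b / alpha) w; rewrite B_indep subKr addr0 => <-.
    by congr (A _ _); field.
  have -> : y + alpha * (Phi t1 - Phi t2) = alpha * (w + Phi t1) by rewrite /w; field.
  by rewrite wE -(wE t2); congr (A _ _); rewrite /w; field.
pose A0 := A 0 0; pose b2 := B 0 0; pose beta := A 1 0 - A0.
have gA b x : A (alpha * (b + x)) 0 = alpha' * (A b 0 + B 0 x).
  by rewrite -(f1 0 x b 0) [RHS]A_indep.
have BA x : B 0 x = A x 0 - A0 + b2.
  have := gA 0 x; rewrite add0r -[x in A (_ * x)]addr0 gA => /(mulfI alpha'0) eqB.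
  by rewrite -(addKr A0 (B 0 x)) -eqB; ring.
have AE b : A b 0 = A0 + beta * b.
  rewrite (affine_step (f := fun b => A b 0) (k := 1) (L := beta));
    rewrite ?oner_neq0 ?divr1 // => {}b.
  have := gA b 1; have := gA (b + 1) 0; rewrite addr0 => ->; rewrite (BA 1).
  by move=> /(mulfI alpha'0) eqA; apply: (addIr b2); rewrite eqA /beta; ring.
have beta0 : beta != 0.
  apply/eqP=> beta_0; have /(congr1 fst)/eqP : (0 : F, 0 : F) = (1, 0).
    apply: (bij_inj f_bij).
    rewrite [f (0, 0)]surjective_pairing [f (1, 0)]surjective_pairing.
    by rewrite -!/(A _ _) -!/(B _ _) (B_indep 1) (AE 1) beta_0 mul0r addr0.
  by rewrite /= eq_sym oner_eq0.
have eqA0 : A0 = alpha' * (A0 + b2).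
  by have := gA 0 0; rewrite addr0 mulr0.
have eq_alpha : alpha = alpha'.
  have := gA 1 0; rewrite addr0 mulr1 !AE -/b2 mulr1 => eqA; apply: (mulfI beta0).
  by rewrite -(addKr A0 (beta * alpha)) eqA {1}eqA0; ring.
have key t : alpha * (beta * Phi t) + b2 = alpha * (b2 + Phi' (beta * t)).
  have := f2 0 0 t 0; rewrite !B_indep (BA (_ * _)) !AE -eq_alpha -/b2 subr0.
  have -> : A0 + beta * t - (A0 + beta * 0) = beta * t by ring.
  by move=> <-; ring.
(* For [alpha = 1] this is [eqA0]; otherwise [Phi] and [Phi'] vanish at 0 and [key 0] reads
   [b2 = alpha * b2]. *)
have b20 : b2 = 0.
  have [alpha1|alpha1] := eqVneq alpha 1.
    by move: eqA0; rewrite -eq_alpha alpha1 mul1r -{1}[A0]addr0 => /addrI.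
  have Phi_0 (Psi : F -> F) : Psi (alpha * 0) = alpha * Psi 0 -> Psi 0 = 0.
    rewrite mulr0 -{1}[Psi 0]mul1r => /eqP; rewrite -subr_eq0 -mulrBl mulf_eq0 subr_eq0.
    by rewrite eq_sym (negPf alpha1) => /eqP.
  have := key 0; rewrite mulr0 (Phi_0 Phi) // (Phi_0 Phi') ?eq_alpha // !mulr0 add0r addr0.
  rewrite -eq_alpha => /eqP; rewrite -{1}[b2]mul1r -subr_eq0 -mulrBl mulf_eq0 subr_eq0.
  by rewrite eq_sym (negPf alpha1) => /eqP.
split=> //; exists beta^-1; split=> [|x]; first by rewrite invr_eq0.
have := key (beta^-1 * x); rewrite b20 add0r addr0 => /(mulfI alpha0).
by rewrite invrK mulVKf.
Qed.
End Isomorphisms.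

Theorem corollary5p2 (p : nat) (p_prime : prime p) :
  (forall (X : finType) (r : X * X -> X * X),
     indecomposable_solution r -> #|X| = (p ^ 2)%N ->
     [\/ yb_isomorphic r (@cyclic_map p),
         exists (S : 'F_p) (Phi : 'F_p -> 'F_p),
           translation_param Phi /\ yb_isomorphic r (translation_map S Phi)
       | exists (alpha : 'F_p) (Phi : 'F_p -> 'F_p),
           scaling_param alpha Phi /\
           yb_isomorphic r (scaling_map alpha Phi)]) /\
  [/\ indecomposable_solution (@cyclic_map p),
      forall (S : 'F_p) (Phi : 'F_p -> 'F_p),
        translation_param Phi -> indecomposable_solution (translation_map S Phi)
    & forall (alpha : 'F_p) (Phi : 'F_p -> 'F_p),
        scaling_param alpha Phi ->
        indecomposable_solution (scaling_map alpha Phi)] /\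
  (forall (S S' : 'F_p) (Phi Phi' : 'F_p -> 'F_p),
     translation_param Phi -> translation_param Phi' ->
     (yb_isomorphic (translation_map S Phi) (translation_map S' Phi') <->
      exists alpha : 'F_p,
        [/\ alpha != 0, alpha * S = S' & forall x, alpha * Phi x = Phi' x])) /\
  (forall (alpha alpha' : 'F_p) (Phi Phi' : 'F_p -> 'F_p),
     scaling_param alpha Phi -> scaling_param alpha' Phi' ->
     (yb_isomorphic (scaling_map alpha Phi) (scaling_map alpha' Phi') <->
      alpha = alpha' /\
      exists beta : 'F_p,
        beta != 0 /\ forall x, beta^-1 * Phi (beta * x) = Phi' x)).
Proof.
split; first by move=> X r; exact: classification.
split.
  split=> [|S Phi|alpha Phi]; first exact: cyclic_map_solution.
    exact: translation_map_solution.
  exact: scaling_map_solution.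
split=> [S S' Phi Phi'|alpha alpha' Phi Phi'].
  exact: translation_isomorphic.
exact: scaling_isomorphic.
Qed.
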